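(* Let $\mathbf{A}$ be a finite idempotent algebra with a pseudopartition operation $x\vee y$, such that all blocks of its semilattice replica congruence $\sigma$ (which are subalgebras of $\mathbf{A}$) lie in one and the same tractable variety. Then $\operatorname{CSP}(\mathbf{A})$ is tractable.
   Context: Algebras have a plural similarity type: no nullary operation symbols and at least one non-unary operation symbol. An algebra is idempotent if every basic operation $f$ satisfies $f(x,\dots,x)\approx x$. A binary term $x\vee y$ of an algebra $\mathbf{A}$ is a pseudopartition operation if $\mathbf{A}$ satisfies the identities $x\vee x\approx x$; $(x\vee y)\vee z\approx x\vee(y\vee z)$; $x\vee(y\vee z)\approx x\vee(z\vee y)$; and, for every basic operation $f$ (of arity $n$), $y\vee f(x_1,\dots,x_n)\approx y\vee x_1\vee\cdots\vee x_n$. The relation $\sigma=\{(a,b): a\vee b=a\text{ and }b\vee a=b\}$ is then a congruence of $\mathbf{A}$, called the semilattice replica congruence. Constraint satisfaction: for a set $\Gamma$ of finitary relations on a finite set $A$, $\operatorname{CSP}(\Gamma)$ is the decision problem whose instances are triples $(V,A,\mathcal{C})$ with $V$ a finite set of variables and $\mathcal{C}=\{(S_i,R_i): i=1,\dots,n\}$ where each $S_i$ is an $m_i$-tuple of variables and $R_i\in\Gamma$ is $m_i$-ary; the question is whether there is a map $f\colon V\to A$ with $f(S_i)\in R_i$ for all $i$. $\Gamma$ is tractable if for every finite $\Delta\subseteq\Gamma$, $\operatorname{CSP}(\Delta)$ lies in $\mathbf{P}$. For a finite algebra $\mathbf{A}=\langle A,\mathcal{F}\rangle$, $\operatorname{Inv}(\mathcal{F})$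 is the set of finitary relations on $A$ invariant under every $f\in\mathcal{F}$ (equivalently, the subuniverses of finite powers of $\mathbf{A}$); $\operatorname{CSP}(\mathbf{A})$ means $\operatorname{CSP}(\operatorname{Inv}(\mathcal{F}))$, and $\mathbf{A}$ (or $\operatorname{CSP}(\mathbf{A})$) is tractable if $\operatorname{Inv}(\mathcal{F})$ is tractable. A variety is tractable if every finite algebra in it is tractable. *)

(* Defs.v *)
From HB Require Import structures.
From mathcomp Require Import all_boot.

Set Implicit Arguments.
Unset Strict Implicit.
Unset Printing Implicit Defensive.

(** * Universal algebra *)

Record signature := Signature { symbol : Type; arity : symbol -> nat }.

Definition plural (S : signature) : Prop :=
  (forall f : symbol S, 0 < arity f) /\ (exists f : symbol S, 1 < arity f).

(* The empty algebra is allowed: there are no nullary symbols, and it is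
   harmless in everything below, as it is trivially tractable. *)
Record algebra (S : signature) := Algebra {
  carrier :> Type;
  op : forall f : symbol S, (arity f).-tuple carrier -> carrier }.

Record fin_algebra (S : signature) := FinAlgebra {
  fcarrier :> finType;
  fop : forall f : symbol S, (arity f).-tuple fcarrier -> fcarrier }.

Definition algebra_of (S : signature) (A : fin_algebra S) : algebra S :=
  Algebra (@fop S A).
Coercion algebra_of : fin_algebra >-> algebra.

Inductive term (S : signature) (X : Type) : Type :=
| Var of X
| App (f : symbol S) of ('I_(arity f) -> term S X).

Fixpoint eval (S : signature) (A : algebra S) (X : Type) (env : X -> A)
    (t : term S X) : A :=
  match t with
  | Var x => env x
  | App f ts => op [tuple eval env (ts i) | i < arity f]
  end.

Definition eval2 (S : signature) (A : algebra S) (t : term S 'I_2) (x y : A) : A :=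
  eval (tnth [tuple x; y]) t.

Definition idempotent_algebra (S : signature) (A : algebra S) : Prop :=
  forall (f : symbol S) (x : A), op [tuple x | _ < arity f] = x.

Definition pseudopartition (S : signature) (A : algebra S) (t : term S 'I_2) : Prop :=
  let join := eval2 (A := A) t in
  [/\ forall x, join x x = x,
      forall x y z, join (join x y) z = join x (join y z),
      forall x y z, join x (join y z) = join x (join z y)
    & forall (f : symbol S) (y : A) (xs : (arity f).-tuple A),
        join y (op xs) = foldl join y xs].

Definition is_hom (S : signature) (A B : algebra S) (h : A -> B) : Prop :=
  forall (f : symbol S) (xs : (arity f).-tuple A),
    h (op xs) = op (map_tuple h xs).

Definition product_algebra (S : signature) (I : Type) (F : I -> algebra S) :
    algebra S :=
  @Algebra S (forall i, F i) (fun f xs i => op (map_tuple (fun x => x i) xs)).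

Definition subuniverse (S : signature) (A : algebra S) (P : pred A) : Prop :=
  forall (f : symbol S) (xs : (arity f).-tuple A), all P xs -> P (op xs).

Lemma all_val (T : Type) (P : pred T) (n : nat) (xs : n.-tuple {x | P x}) :
  all P (map_tuple val xs).
Proof. by rewrite /= all_map; elim: (tval xs) => //= x s ->; rewrite (valP x). Qed.

Definition subalgebra (S : signature) (A : algebra S) (P : pred A)
    (clP : subuniverse P) : algebra S :=
  @Algebra S {x : A | P x}
    (fun f xs => exist _ (op (map_tuple val xs)) (clP f _ (all_val xs))).

(* Subalgebras are taken up to isomorphism, via injective homomorphisms. *)
Definition variety (S : signature) (K : algebra S -> Prop) : Prop :=
  [/\ forall (A B : algebra S) (h : A -> B),
        is_hom h -> (forall b, exists a, h a = b) -> K A -> K B,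
      forall (A B : algebra S) (h : A -> B),
        is_hom h -> injective h -> K B -> K A
    & forall (I : Type) (F : I -> algebra S),
        (forall i, K (F i)) -> K (product_algebra F)].

(** * The semilattice replica congruence *)

Definition sigma (S : signature) (A : fin_algebra S) (t : term S 'I_2) : rel A :=
  fun a b => (eval2 (A := A) t a b == a) && (eval2 (A := A) t b a == b).

Definition congruence (S : signature) (A : algebra S) (r : rel A) : Prop :=
  equivalence_rel r /\
  forall (f : symbol S) (xs ys : (arity f).-tuple A),
    (forall i, r (tnth xs i) (tnth ys i)) -> r (op xs) (op ys).

Section Sigma.
Variables (S : signature) (A : fin_algebra S) (t : term S 'I_2).
Hypothesis ppA : pseudopartition A t.

Local Notation join := (eval2 (A := A) t).

Lemma sigma_equiv : equivalence_rel (sigma (A := A) t).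
Proof.
case: ppA => jxx jA jC _.
have sym x y : sigma t x y -> sigma (A := A) t y x by rewrite /sigma andbC.
have trans x y z : sigma t x y -> sigma t y z -> sigma (A := A) t x z.
  case/andP=> /eqP xy /eqP yx /andP[/eqP yz /eqP zy].
  apply/andP; split; apply/eqP; first by rewrite -{1}xy jA yz xy.
  by rewrite -{1}zy jA yx zy.
move=> x y z; split; first by rewrite /sigma jxx eqxx.
by move=> xy; apply/idP/idP; apply: trans => //; apply: sym.
Qed.

Lemma sigma_congruence : congruence (A := A) (sigma (A := A) t).
Proof.
case: (ppA) => jxx jA jC jop; split; first exact: sigma_equiv.
have half f (xs ys : (arity f).-tuple A) :
    (forall i, sigma (A := A) t (tnth xs i) (tnth ys i)) ->
    join (op (a := A) xs) (op (a := A) ys) = op (a := A) xs.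
  move=> xy; rewrite -{1}(jxx (op _)) !jop.
  have jrC u v w : join (join u v) w = join (join u w) v by rewrite !jA jC.
  have fjC u v s : foldl join (join u v) s = join (foldl join u s) v.
    by elim: s u => //= w s IHs u; rewrite jrC IHs.
  have key (s r : seq A) u : size s = size r ->
      (forall i, i < size s -> sigma (A := A) t (nth u s i) (nth u r i)) ->
      forall v, foldl join (foldl join v s) r = foldl join v s.
    elim: s r => [|x s IHs] [|y r] //= [sz] h v.
    rewrite !fjC jA IHs //; last by move=> i; apply: (h i.+1).
    by have /andP[/eqP -> _] := h 0 isT.
  rewrite (key _ _ (op (a := A) xs)) ?size_tuple //; first by rewrite -jop jxx.
  by move=> i lti; have := xy (Ordinal lti); rewrite !(tnth_nth (op (a := A) xs)).
move=> f xs ys xy; apply/andP; split; apply/eqP; apply: half => // i.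
by rewrite /sigma andbC; apply: xy.
Qed.

Hypothesis idA : idempotent_algebra A.

Lemma block_subuniverse (a : A) : subuniverse (A := A) (sigma (A := A) t a).
Proof.
move=> f xs /all_tnthP xs_a; rewrite -{1}(idA f a).
by apply: (proj2 sigma_congruence) => i; rewrite tnth_mktuple.
Qed.

Definition block_algebra (a : A) : algebra S :=
  subalgebra (@block_subuniverse a).

End Sigma.

(** * The class P *)

Section TuringMachine.

Inductive move := MoveLeft | Stay | MoveRight.

(* [None] is the blank.  The lists start next to the head; cells beyond their
   ends are blank. *)
Record tape (C : Type) := Tape {
  left_cells : seq (option C);
  head_cell : option C;
  right_cells : seq (option C) }.

Definition blank_tape (C : Type) : tape C := Tape [::] None [::].

Definition write_move (C : Type) (T : tape C) (wm : option C * move) : tape C :=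
  let: (c, m) := wm in
  match m with
  | Stay => Tape (left_cells T) c (right_cells T)
  | MoveLeft =>
      if left_cells T is d :: l then Tape l d (c :: right_cells T)
      else Tape [::] None (c :: right_cells T)
  | MoveRight =>
      if right_cells T is d :: r then Tape (c :: left_cells T) d r
      else Tape (c :: left_cells T) None [::]
  end.

(* Deterministic Turing machines with [ntapes.+1] tapes; the tape symbols are
   the input letters and the work symbols. *)
Record machine (Sigma : finType) := Machine {
  ntapes : nat;
  state : finType;
  work_symbol : finType;
  start : state;
  halting : pred state;
  accepting : pred state;
  delta : state -> ntapes.+1.-tuple (option (Sigma + work_symbol)) ->
          state * ntapes.+1.-tuple (option (Sigma + work_symbol) * move) }.

Variables (Sigma : finType) (M : machine Sigma).

Definition cell : Type := (Sigma + work_symbol M)%type.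
Definition config : Type := (state M * (ntapes M).+1.-tuple (tape cell))%type.

Definition input_tape (w : seq Sigma) : tape cell :=
  if w is a :: v then Tape [::] (Some (inl a)) [seq Some (inl b) | b <- v]
  else blank_tape cell.

Definition initial (w : seq Sigma) : config :=
  (start M, [tuple if i == ord0 then input_tape w else blank_tape cell
            | i < (ntapes M).+1]).

Definition step (c : config) : config :=
  let: (q, ts) := c in
  if halting q then c else
  let: (q', acts) := delta q (map_tuple (@head_cell cell) ts) in
  (q', [tuple write_move (tnth ts i) (tnth acts i) | i < (ntapes M).+1]).

Definition decides_within (L : seq Sigma -> Prop) (time : nat -> nat) : Prop :=
  forall w : seq Sigma,
    let: (q, _) := iter (time (size w)) step (initial w) in
    halting q /\ (accepting q <-> L w).

End TuringMachine.

Definition in_P (Sigma : finType) (L : seq Sigma -> Prop) : Prop :=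
  exists (M : machine Sigma) (c d : nat),
    decides_within M L (fun n => c * n.+1 ^ d).

(** * Constraint satisfaction *)

Definition relation (A : finType) : Type := {n : nat & {set n.-tuple A}}.
HB.instance Definition _ (A : finType) := Choice.on (relation A).

Section CSP.
Variables (A : finType) (Delta : seq (relation A)).

Definition constraint (n : nat) : Type :=
  {R : seq_sub Delta & (tag (val R)).-tuple 'I_n}.

Record instance := Instance {
  nvars : nat;
  constraints : seq (constraint nvars) }.

Definition satisfied (n : nat) (f : 'I_n -> A) (C : constraint n) : bool :=
  map_tuple f (tagged C) \in tagged (val (tag C)).

Definition satisfiable (I : instance) : Prop :=
  exists f : 'I_(nvars I) -> A, all (satisfied f) (constraints I).

(* Instances are words over one letter for each of the finitely many relations,
   a tally and a separator.  Variables are written in unary; as the set of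
   variables is itself part of the instance and is written out, this changes
   lengths only polynomially with respect to binary names. *)
Definition letter : finType := (seq_sub Delta + bool)%type.
Definition tally : letter := inr true.
Definition separator : letter := inr false.

Definition encode_nat (n : nat) : seq letter := rcons (nseq n tally) separator.

Definition encode_constraint (n : nat) (C : constraint n) : seq letter :=
  inl (tag C) :: flatten [seq encode_nat (i : 'I_n) | i <- tagged C].

Definition encode (I : instance) : seq letter :=
  encode_nat (nvars I) ++ flatten (map (@encode_constraint _) (constraints I)).

Definition CSP (w : seq letter) : Prop :=
  exists I : instance, w = encode I /\ satisfiable I.

End CSP.

Definition tractable (A : finType) (Gamma : relation A -> Prop) : Prop :=
  forall Delta : seq (relation A),
    (forall R, R \in Delta -> Gamma R) -> in_P (@CSP A Delta).

Definition Inv (S : signature) (A : fin_algebra S) (R : relation A) : Prop :=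
  forall (f : symbol S) (xs : (arity f).-tuple ((tag R).-tuple A)),
    (forall i, tnth xs i \in tagged R) ->
    [tuple op (a := A) [tuple tnth (tnth xs i) j | i < arity f] | j < tag R]
      \in tagged R.

Definition tractable_algebra (S : signature) (A : fin_algebra S) : Prop :=
  tractable (@Inv S A).

Definition tractable_variety (S : signature) (K : algebra S -> Prop) : Prop :=
  variety K /\ forall A : fin_algebra S, K A -> tractable_algebra A.

(* Main.v *)
From HB Require Import structures.
Require Import Defs.
From mathcomp Require Import all_boot zify ring.

Set Implicit Arguments.
Unset Strict Implicit.
Unset Printing Implicit Defensive.

(** Let an instance of the constraint satisfaction problem of [A] be given, and
    let [D v] be the set of values that arc consistency leaves to the variable
    [v], so that the tuples of each constraint that lie in the product of the
    sets [D v] project onto each of them.  A join of several elements depends only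
    on its first factor and on the set of the others, and up to [sigma] only on the
    set of all of them.  Hence, if [g] solves the instance, joining [g v] with all
    the elements of [D v] leads into the block of the join of [D v], which does not
    depend on [g].  The new map is again a solution: on a constraint it agrees with
    the join, taken inside the invariant relation, of the tuple given by [g] and all
    the tuples that arc consistency has left ([stable_holds], [eq_joins]).  So the
    instance is solvable if and only if it has a solution that takes its values in
    these blocks ([sigma_joins]).

    The blocks vary with the variable, but one algebra serves them all: the
    product of the blocks of all the elements of [A], which lies in the given
    variety ([selector_in_variety]) and therefore is tractable.  A variable with
    set [D v] ranges over this product and is read off at the coordinate of the
    representative of [D v] ([block_relation], [localize_reduction]).

    It remains to compute the translated instance in polynomial time on a Turing
    machine.  The machine keeps on a second tape one symbol for each variable,
    the set of values still allowed, and runs over the input again and again,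
    shrinking these sets.  As variables are named in unary, following a name
    means moving both heads in parallel.  Each pass but the last makes the total
    size of the sets drop, so that there are linearly many passes, each of linear
    length; a final pass writes the translated instance
    ([propagator_done], [CSP_reduction]).  Feeding it to the machine that decides
    the translated problem gives the result ([transducer_in_P]).

    When [A] is empty there are no blocks; then [A] embeds into the empty product
    and is itself in the variety ([empty_in_variety]). *)

(** * Bounded runs of a step function *)

Section Reach.
Variables (U : Type) (f : U -> U).

Definition reach (n : nat) (x y : U) : Prop := exists2 k, k <= n & iter k f x = y.

Lemma reach0 x : reach 0 x x.
Proof. by exists 0. Qed.

Lemma reach1 x : reach 1 x (f x).
Proof. by exists 1. Qed.

Lemma reach_trans y m n x z : reach m x y -> reach n y z -> reach (m + n) x z.
Proof. by move=> [k lek <-] [l lel <-]; exists (l + k); rewrite ?iterD //; lia. Qed.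

Lemma reach_leq m n x y : reach m x y -> m <= n -> reach n x y.
Proof. by move=> [k lek <-] le; exists k => //; lia. Qed.

Lemma reach_step n x y : reach n (f x) y -> reach n.+1 x y.
Proof. exact: reach_trans (reach1 x). Qed.

Lemma iter_fixed n x : f x = x -> iter n f x = x.
Proof. by move=> fx; elim: n => //= n ->. Qed.

Lemma reach_iter n x y : reach n x y -> f y = y -> iter n f x = y.
Proof. by move=> [k lek <-] fy; rewrite -(subnK lek) iterD iter_fixed. Qed.

Lemma reach_uniq m n x y z :
  reach m x y -> f y = y -> reach n x z -> f z = z -> y = z.
Proof.
move=> xy fy xz fz; rewrite -(reach_iter (reach_leq xy (leq_addr n m)) fy).
exact: reach_iter (reach_leq xz (leq_addl m n)) fz.
Qed.

End Reach.

Lemma reach_map (U V : Type) (f : U -> U) (g : V -> V) (h : U -> V) n x y :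
  (forall u, h (f u) = g (h u)) -> reach f n x y -> reach g n (h x) (h y).
Proof.
move=> hfg [k lek <-]; exists k => // {lek}.
by elim: k => //= k ->; rewrite hfg.
Qed.

(** * Tapes without trailing blanks *)

Section Tapes.
Variable C : Type.
Implicit Types (T : tape C) (c : option C).

(** Blanks at the far end of a half tape cannot be observed by the head.  Dropping
    them makes the tape a function of what is written on it, so that the
    configurations of a run can be given by equations. *)
Definition ncons c l := if (c, l) is (None, [::]) then [::] else c :: l.

Definition strip l := foldr ncons [::] l.

Definition norm_tape T :=
  Tape (strip (left_cells T)) (head_cell T) (strip (right_cells T)).

Definition nwrite T (wm : option C * move) : tape C :=
  let: Tape l _ r := T in
  let: (c, m) := wm in
  match m with
  | Stay => Tape l c r
  | MoveLeft => Tape (behead l) (head None l) (ncons c r)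
  | MoveRight => Tape (ncons c l) (head None r) (behead r)
  end.

Lemma head_strip l : head None (strip l) = head None l.
Proof. by case: l => //= -[a|] l //=; case: (strip l). Qed.

Lemma behead_strip l : behead (strip l) = strip (behead l).
Proof. by case: l => //= -[a|] l //=; case: (strip l). Qed.

Lemma norm_write T wm : norm_tape (write_move T wm) = nwrite (norm_tape T) wm.
Proof.
case: T wm => l h r [c []] //=; rewrite /norm_tape head_strip behead_strip.
  by case: l.
by case: r.
Qed.

Lemma nwrite_stay T : nwrite T (head_cell T, Stay) = T.
Proof. by case: T. Qed.

(** The word [rev l ++ r] on an otherwise blank tape, the head being on the first
    letter of [r], or on the blank behind the word when [r] is empty. *)
Definition zipper (l r : seq C) : tape C :=
  Tape (map Some l) (ohead r) (map Some (behead r)).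

Lemma norm_zipper l r : norm_tape (zipper l r) = zipper l r.
Proof.
have stripS s : strip (map Some s) = map Some s by elim: s => //= a s ->.
by rewrite /norm_tape /= !stripS.
Qed.

Lemma zipper_right l r a :
  nwrite (zipper l r) (Some a, MoveRight) = zipper (a :: l) (behead r).
Proof. by case: r => [|b []]. Qed.

Lemma zipper_left a l r :
  nwrite (zipper (a :: l) r) (ohead r, MoveLeft) = zipper l (a :: r).
Proof. by case: r. Qed.

Lemma zipper_put l b r a : nwrite (zipper l (b :: r)) (Some a, Stay) = zipper l (a :: r).
Proof. by []. Qed.

(** Stepping off the left end of the word and back would leave a blank behind on a
    tape that is not normalised. *)
Lemma zipper_bounce r :
  nwrite (nwrite (zipper [::] r) (ohead r, MoveLeft)) (None, MoveRight) = zipper [::] r.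
Proof. by case: r. Qed.

End Tapes.

Definition map_tape (C C' : Type) (e : C -> C') (T : tape C) : tape C' :=
  Tape (map (omap e) (left_cells T)) (omap e (head_cell T))
       (map (omap e) (right_cells T)).

Definition map_act (C C' : Type) (e : C -> C') (wm : option C * move) :=
  (omap e wm.1, wm.2).

Lemma map_nwrite (C C' : Type) (e : C -> C') T wm :
  map_tape e (nwrite T wm) = nwrite (map_tape e T) (map_act e wm).
Proof.
have mapn c l : map (omap e) (ncons c l) = ncons (omap e c) (map (omap e) l).
  by case: c l => [a|] [].
by case: T wm => [[|a l] h [|b r]] [c []] //=; rewrite /map_tape /= ?mapn.
Qed.

Lemma map_zipper (C C' : Type) (e : C -> C') l r :
  map_tape e (zipper l r) = zipper (map e l) (map e r).
Proof. by case: r => [|a r]; rewrite /map_tape /zipper /= -!map_comp. Qed.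

(** * Machines on normalised tapes *)

Section NormalMachine.
Variables (Sigma : finType) (M : machine Sigma).

Definition nstep (c : config M) : config M :=
  let: (q, ts) := c in
  if halting q then c else
  let: (q', acts) := delta q (map_tuple (@head_cell (cell M)) ts) in
  (q', [tuple nwrite (tnth ts i) (tnth acts i) | i < (ntapes M).+1]).

Definition norm_config (c : config M) : config M :=
  (c.1, map_tuple (@norm_tape _) c.2).

Lemma norm_step c : norm_config (step c) = nstep (norm_config c).
Proof.
case: c => q ts /=; rewrite /norm_config /=; case: ifP => //= _.
have -> : map_tuple (@head_cell _) (map_tuple (@norm_tape _) ts)
        = map_tuple (@head_cell _) ts.
  by apply: eq_from_tnth => i; rewrite !tnth_map.
case: (delta q _) => q' acts /=; congr (_, _).
by apply: eq_from_tnth => i; rewrite !(tnth_map, tnth_ord_tuple) norm_write.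
Qed.

Lemma norm_run n c : norm_config (iter n (@step _ M) c) = iter n nstep (norm_config c).
Proof. by elim: n => //= n <-; rewrite norm_step. Qed.

Definition ninitial (w : seq Sigma) : config M :=
  (start M, [tuple if i == ord0 then zipper [::] (map inl w)
                   else zipper [::] [::] | i < (ntapes M).+1]).

Lemma norm_initial w : norm_config (initial M w) = ninitial w.
Proof.
congr (_, _); apply: eq_from_tnth => i; rewrite !(tnth_map, tnth_ord_tuple).
case: ifP => // _; rewrite -[RHS]norm_zipper.
by case: w => [|a w] //=; rewrite /zipper /= -map_comp.
Qed.

Lemma nstep_halted c : halting c.1 -> nstep c = c.
Proof. by case: c => q ts /= ->. Qed.

Lemma decides_normal (L : seq Sigma -> Prop) time :
  decides_within M L time <->
  forall w, exists c, [/\ reach nstep (time (size w)) (ninitial w) c,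
                          halting c.1 & accepting c.1 <-> L w].
Proof.
split=> [dec w | dec w].
  have := dec w; case E: (iter _ _ _) => [q ts] [hq accq].
  exists (norm_config (q, ts)); split=> //.
  by exists (time (size w)) => //; rewrite -E norm_run norm_initial.
have [c [rc hc accc]] := dec w; case E: (iter _ _ _) => [q ts].
have := norm_run (time (size w)) (initial M w).
rewrite norm_initial (reach_iter rc (nstep_halted hc)) E => /(congr1 fst) /= ->.
by split.
Qed.

End NormalMachine.

Arguments nstep {Sigma M} c : simpl never.

(** * Reductions by transducers *)

(** A device with two tapes, the first of which carries the input, and an output
    that is only ever appended to, so that the output can be kept as a word instead
    of a tape.  The cells of both tapes hold input letters or work symbols. *)
Record transducer (Sigma Sigma' : finType) := Transducer {
  tstate : finType;
  twork : finType;
  tstart : tstate;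
  tdone : pred tstate;
  tfail : pred tstate;
  tdelta : tstate ->
    option (Sigma + twork) -> option (Sigma + twork) ->
    tstate * (option (Sigma + twork) * move) * (option (Sigma + twork) * move)
    * option Sigma' }.

Section TransducerRun.
Variables (Sigma Sigma' : finType) (N : transducer Sigma Sigma').

Definition tcell : Type := (Sigma + twork N)%type.
Definition tconfig : Type := (tstate N * tape tcell * tape tcell * seq Sigma')%type.

Definition tstep (c : tconfig) : tconfig :=
  let: (q, X, D, out) := c in
  if tdone q || tfail q then c else
  let: (q', aX, aD, e) := tdelta q (head_cell X) (head_cell D) in
  (q', nwrite X aX, nwrite D aD, out ++ seq_of_opt e).

Definition tinitial (w : seq Sigma) : tconfig :=
  (tstart N, zipper [::] (map inl w), zipper [::] [::], [::]).

(** At most one letter is written at each step, so the output of a polynomial run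
    is of polynomial length. *)
Lemma size_output n c : size (iter n tstep c).2 <= size c.2 + n.
Proof.
elim: n => /= [|n]; first by rewrite addn0.
case: (iter n tstep c) => -[[q X] D] out /= IHn.
case: ifP => // _; first by rewrite addnS leqW.
case: (tdelta _ _ _) => -[[q' aX] aD] e /=; rewrite size_cat.
by case: e => [a|] /=; lia.
Qed.

Definition reduces_within (L : seq Sigma -> Prop) (L' : seq Sigma' -> Prop)
    (time : nat -> nat) : Prop :=
  forall w, exists q X D out,
    reach tstep (time (size w)) (tinitial w) (q, X, D, out) /\
    ((tfail q /\ ~ L w) \/ ([/\ tdone q, ~~ tfail q & L w <-> L' out])).

End TransducerRun.

Definition cons2 (U : Type) n (a b : U) (s : n.-tuple U) : n.+2.-tuple U :=
  cons_tuple a (cons_tuple b s).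

Lemma behead_cons2 (U : Type) n (a b : U) (s : n.-tuple U) :
  behead_tuple (behead_tuple (cons2 a b s)) = s.
Proof. exact: val_inj. Qed.

Section Composition.
Variables (Sigma Sigma' : finType) (N : transducer Sigma Sigma') (M : machine Sigma').

(** The composite runs [N] on its first two tapes and writes the output of [N] on
    the third one, which is the input tape of [M]; the other tapes of [M] stay
    blank.  It then rewinds the third tape and runs [M] on the third and the
    following tapes.  The summand [unit] of [comp_state] is the rewinding state. *)
Definition comp_cell : Type := (Sigma + (twork N + cell M))%type.

Definition left_cell (c : tcell N) : comp_cell :=
  match c with inl a => inl a | inr t => inr (inl t) end.
Definition right_cell (c : cell M) : comp_cell := inr (inr c).
Definition of_left (c : comp_cell) : option (tcell N) :=
  match c with
  | inl a => Some (inl a)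
  | inr (inl t) => Some (inr t)
  | inr (inr _) => None
  end.
Definition of_right (c : comp_cell) : option (cell M) :=
  if c is inr (inr c') then Some c' else None.

Lemma of_leftK o : obind of_left (omap left_cell o) = o.
Proof. by case: o => //= -[]. Qed.

Lemma of_rightK o : obind of_right (omap right_cell o) = o.
Proof. by case: o. Qed.

Definition comp_state : Type := (tstate N + (unit + state M))%type.

Definition on_output (hs : (ntapes M).+1.-tuple (option comp_cell)) a :=
  [tuple if i == ord0 then a else (tnth hs i, Stay) | i < (ntapes M).+1].

Definition comp_delta (q : comp_state)
    (heads : (ntapes M).+3.-tuple (option comp_cell)) :
    comp_state * (ntapes M).+3.-tuple (option comp_cell * move) :=
  let x := thead heads in
  let d := thead (behead_tuple heads) in
  let hs := behead_tuple (behead_tuple heads) in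
  match q with
  | inl q =>
      if tdone q then
        (inr (inl tt), cons2 (x, Stay) (d, Stay) (on_output hs (thead hs, MoveLeft)))
      else
        let: (q', aX, aD, e) := tdelta q (obind of_left x) (obind of_left d) in
        (inl q', cons2 (map_act left_cell aX) (map_act left_cell aD)
          (on_output hs (if e is Some a then (Some (right_cell (inl a)), MoveRight)
                        else (thead hs, Stay))))
  | inr (inl _) =>
      if thead hs is None then
        (inr (inr (start M)), cons2 (x, Stay) (d, Stay) (on_output hs (None, MoveRight)))
      else (q, cons2 (x, Stay) (d, Stay) (on_output hs (thead hs, MoveLeft)))
  | inr (inr q) =>
      let: (q', acts) := delta q (map_tuple (obind of_right) hs) in
      (inr (inr q'), cons2 (x, Stay) (d, Stay) (map_tuple (map_act right_cell) acts))
  end.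

Definition comp_machine : machine Sigma :=
  @Machine Sigma (ntapes M).+2 (tstate N + (unit + state M))%type
    (twork N + (Sigma' + work_symbol M))%type
    (inl (tstart N))
    (fun q => match q with
              | inl q => tfail q
              | inr (inl _) => false
              | inr (inr q) => halting q
              end)
    (fun q => if q is inr (inr q) then accepting q else false)
    comp_delta.

Definition comp_config (q : comp_state) (X D : tape comp_cell)
    (Ts : (ntapes M).+1.-tuple (tape comp_cell)) : config comp_machine :=
  (q, cons2 X D Ts).

Lemma comp_stepE q X D Ts :
  ~~ @halting _ comp_machine q ->
  forall q' aX aD aT,
  comp_delta q (cons2 (head_cell X) (head_cell D) (map_tuple (@head_cell _) Ts))
    = (q', cons2 aX aD aT) ->
  nstep (comp_config q X D Ts) =
    comp_config q' (nwrite X aX) (nwrite D aD)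
      [tuple nwrite (tnth Ts i) (tnth aT i) | i < (ntapes M).+1].
Proof.
rewrite /nstep /comp_config => nhq q' aX aD aT qE; rewrite (negbTE nhq).
have -> : map_tuple (@head_cell (cell comp_machine)) (cons2 X D Ts)
   = cons2 (head_cell X) (head_cell D) (map_tuple (@head_cell _) Ts).
  exact: val_inj.
rewrite /delta /= qE; congr (_, _); apply: eq_from_tnth => i.
rewrite tnth_mktuple.
case: (unliftP ord0 i) => [j ->|->]; last by rewrite !tnth0.
rewrite !tnthS; case: (unliftP ord0 j) => [k ->|->]; last by rewrite !tnth0.
by rewrite !tnthS tnth_mktuple.
Qed.

Definition output_tapes (O : tape comp_cell) :=
  [tuple if i == ord0 then O else zipper [::] [::] | i < (ntapes M).+1].

Lemma output_heads O : thead (map_tuple (@head_cell _) (output_tapes O)) = head_cell O.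
Proof. by rewrite /thead tnth_map tnth_mktuple. Qed.

Lemma on_output_write O a :
  [tuple nwrite (tnth (output_tapes O) i)
     (tnth (on_output (map_tuple (@head_cell _) (output_tapes O)) a) i)
   | i < (ntapes M).+1] = output_tapes (nwrite O a).
Proof.
apply: eq_from_tnth => i; rewrite !tnth_mktuple tnth_map tnth_mktuple.
by case: ifP => // _; rewrite nwrite_stay.
Qed.

Lemma comp_output_step q q' X D O a : ~~ @halting _ comp_machine q ->
  comp_delta q (cons2 (head_cell X) (head_cell D) (map_tuple (@head_cell _) (output_tapes O)))
  = (q', cons2 (head_cell X, Stay) (head_cell D, Stay)
           (on_output (map_tuple (@head_cell _) (output_tapes O)) a)) ->
  nstep (comp_config q X D (output_tapes O))
  = comp_config q' X D (output_tapes (nwrite O a)).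
Proof.
by move=> nhq qE; rewrite (comp_stepE nhq qE) !nwrite_stay on_output_write.
Qed.

Definition output_word (out : seq Sigma') : seq comp_cell :=
  [seq right_cell (inl a) | a <- out].

(** As letters are written moving to the right, the output tape has its head behind
    the output while [N] is running. *)
Definition tconfig_comp (c : tconfig N) : config comp_machine :=
  let: (q, X, D, out) := c in
  comp_config (inl q) (map_tape left_cell X) (map_tape left_cell D)
    (output_tapes (zipper (rev (output_word out)) [::])).

Lemma tstep_comp c (q := c.1.1.1) : ~~ tdone q ->
  tconfig_comp (tstep c) = nstep (tconfig_comp c).
Proof.
case: c @q => -[[q X] D] out /= nd; rewrite (negbTE nd) /=.
have [fq|nfq] := boolP (tfail q); first by rewrite nstep_halted.
case E: (tdelta _ _ _) => [[[q' aX] aD] e] /=.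
rewrite (@comp_stepE _ _ _ _ _ (inl q') (map_act left_cell aX) (map_act left_cell aD)
  (on_output (map_tuple (@head_cell _) (output_tapes (zipper (rev (output_word out)) [::])))
     (if e is Some a then (Some (right_cell (inl a)), MoveRight)
      else (None, Stay)))) //; last first.
  rewrite /comp_delta (negbTE nd) behead_cons2 output_heads.
  by rewrite /thead /= !of_leftK E.
rewrite -!map_nwrite on_output_write; congr (comp_config _ _ _ (output_tapes _)).
case: e {E} => [a|]; last by rewrite /= cats0.
by rewrite zipper_right /output_word map_cat rev_cat.
Qed.

Lemma comp_rewind X D l r :
  reach (@nstep _ comp_machine) (size l).+1
    (comp_config (inr (inl tt)) X D
       (output_tapes (nwrite (zipper l r) (ohead r, MoveLeft))))
    (comp_config (inr (inr (start M))) X D (output_tapes (zipper [::] (rev l ++ r)))).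
Proof.
elim: l r => [|a l IHl] r; apply: reach_step.
  rewrite (@comp_output_step _ (inr (inr (start M))) _ _ _ (None, MoveRight)) //.
    by rewrite zipper_bounce; apply: reach0.
  by rewrite /comp_delta behead_cons2 output_heads.
rewrite zipper_left (@comp_output_step _ (inr (inl tt)) _ _ _ (Some a, MoveLeft)) //.
  by rewrite rev_cons cat_rcons; apply: IHl.
by rewrite /comp_delta behead_cons2 output_heads.
Qed.

Definition mconfig_comp X D (c : config M) : config comp_machine :=
  comp_config (inr (inr c.1)) X D (map_tuple (map_tape right_cell) c.2).

Lemma mstep_comp X D c : mconfig_comp X D (nstep c) = nstep (mconfig_comp X D c).
Proof.
case: c => q ts.
have [hq|nhq] := boolP (halting q); first by rewrite !nstep_halted.
case E: (delta q (map_tuple (@head_cell _) ts)) => [q' acts].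
have -> : nstep (q, ts)
        = (q', [tuple nwrite (tnth ts i) (tnth acts i) | i < (ntapes M).+1]).
  by rewrite /nstep (negbTE nhq) E.
rewrite /mconfig_comp /=.
rewrite (@comp_stepE _ _ _ _ _ (inr (inr q')) (head_cell X, Stay) (head_cell D, Stay)
   (map_tuple (map_act right_cell) acts)) //; last first.
  rewrite /comp_delta behead_cons2.
  have -> : map_tuple (obind of_right) (map_tuple (@head_cell _)
      (map_tuple (map_tape right_cell) ts)) = map_tuple (@head_cell _) ts.
    by apply: eq_from_tnth => i; rewrite !tnth_map /= of_rightK.
  by rewrite E.
rewrite !nwrite_stay; congr comp_config.
by apply: eq_from_tnth => i; rewrite !(tnth_map, tnth_ord_tuple) map_nwrite.
Qed.

Lemma comp_transduce n c :
  reach (@nstep _ comp_machine) n (tconfig_comp c) (tconfig_comp (iter n (@tstep _ _ N) c)).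
Proof.
elim: n c => [|n IHn] c; first exact: reach0.
have [dc|nd] := boolP (tdone c.1.1.1).
  rewrite iter_fixed; first exact: reach_leq (reach0 _ _) _.
  by case: c dc => -[[q X] D] out /= ->.
by apply: reach_step; rewrite -tstep_comp // iterSr.
Qed.

Lemma comp_start w :
  ninitial comp_machine w = tconfig_comp (tinitial N w).
Proof.
congr (_, _); apply: eq_from_tnth => i; rewrite tnth_mktuple !map_zipper -map_comp.
case: (unliftP ord0 i) => [j ->|->]; last by rewrite tnth0.
rewrite tnthS; case: (unliftP ord0 j) => [k ->|->]; last by rewrite tnth0.
by rewrite tnthS tnth_mktuple; case: ifP.
Qed.

(** When [N] is done the head is behind the output, and the first move to the left
    is made before the rewinding state is entered; the run ends in the initial
    configuration of [M] on the output. *)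
Lemma comp_handover X D out :
  reach (@nstep _ comp_machine) (size out + 2)
    (comp_config (inr (inl tt)) X D
       (output_tapes (nwrite (zipper (rev (output_word out)) [::]) (None, MoveLeft))))
    (mconfig_comp X D (ninitial M out)).
Proof.
have := @comp_rewind X D (rev (output_word out)) [::].
rewrite size_rev size_map revK cats0 => run.
apply: (reach_leq (m := (size out).+1)); last by lia.
move: run; congr (reach _ _ _ (comp_config _ _ _ _)).
apply: eq_from_tnth => i; rewrite /= !(tnth_map, tnth_ord_tuple).
by case: ifP => _; rewrite map_zipper -?map_comp.
Qed.

End Composition.

(** The time is the sum of that of [N], of the rewinding, and of [M] on the output;
    since the length of the output is bounded by the time of [N], the bound for [M]
    is a polynomial in a polynomial. *)
Lemma transducer_in_P (Sigma Sigma' : finType) (N : transducer Sigma Sigma')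
    (L : seq Sigma -> Prop) (L' : seq Sigma' -> Prop) (a b : nat) :
  reduces_within N L L' (fun n => a * n.+1 ^ b) -> in_P L' -> in_P L.
Proof.
move=> redN [M [c [d /decides_normal decM]]].
exists (comp_machine N M), (2 * a + 4 + c * a.+1 ^ d), (b + b * d).
apply/decides_normal => w; set n := size w.
have [q [X [D [out [runN outcome]]]]] := redN w.
set t := a * n.+1 ^ b in runN *.
have p1 : 0 < n.+1 ^ b by rewrite expn_gt0.
have p2 : 0 < n.+1 ^ (b * d) by rewrite expn_gt0.
have t_le : t.+1 <= a.+1 * n.+1 ^ b by rewrite mulSn /t; lia.
have bound : t + (t + 3 + c * t.+1 ^ d)
     <= (2 * a + 4 + c * a.+1 ^ d) * n.+1 ^ (b + b * d).
  have le1 : t.+1 ^ d <= a.+1 ^ d * n.+1 ^ (b * d).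
    by rewrite expnM -expnMn; case: d {decM p2} => // d; rewrite leq_exp2r.
  have le2 : c * t.+1 ^ d <= c * a.+1 ^ d * n.+1 ^ (b * d).
    by rewrite -mulnA leq_mul2l le1 orbT.
  rewrite expnD; move: (c * t.+1 ^ d) (c * a.+1 ^ d) le2 => u v le2.
  rewrite /t {t t_le runN le1}.
  move: (n.+1 ^ b) (n.+1 ^ (b * d)) p1 p2 le2 => x y p1 p2 le2.
  have le3 : v * y <= v * (x * y) by rewrite leq_mul2l leq_pmull ?orbT.
  have le4 : x <= x * y by rewrite leq_pmulr.
  nia.
have out_le : size out <= t.
  have [k lek kE] := runN; have := size_output k (tinitial N w).
  by rewrite kE /= => /leq_trans ->.
have runC : reach (@nstep _ (comp_machine N M)) t
    (ninitial (comp_machine N M) w) (tconfig_comp M (q, X, D, out)).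
  have [k lek kE] := runN; rewrite comp_start -kE.
  exact: reach_leq (comp_transduce _ _ _) lek.
case: outcome => [[fq nL]|[dq nfq LL']].
  exists (tconfig_comp M (q, X, D, out)); split=> //.
  by apply: reach_leq runC _; apply: leq_trans bound; apply: leq_addr.
have [c' [runM hc' accc']] := decM out.
exists (mconfig_comp (map_tape (@left_cell _ _ N M) X) (map_tape (@left_cell _ _ N M) D) c').
split=> //=; last by rewrite accc' LL'.
apply: reach_leq bound; apply: reach_trans runC _.
have runM' := reach_map (@mstep_comp _ _ N M (map_tape (@left_cell _ _ N M) X)
   (map_tape (@left_cell _ _ N M) D)) runM.
have le3 : c * (size out).+1 ^ d <= c * t.+1 ^ d.
  by rewrite leq_mul2l; case: (d) => [|d']; rewrite ?orbT // leq_exp2r ?ltnS ?out_le ?orbT.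
have := reach_trans (comp_handover _ _ out) runM' => H.
apply: (@reach_leq _ _ (1 + (size out + 2 + c * (size out).+1 ^ d))); last by lia.
apply: reach_trans (reach1 _ _) _.
rewrite (@comp_output_step _ _ _ _ _ (inr (inl tt)) _ _ _ (None, MoveLeft)) //.
by rewrite /comp_delta dq behead_cons2 output_heads.
Qed.

(** * Words that encode instances *)

Section Words.
Variable rel : Type.
Implicit Types (i n : nat) (c : rel * seq nat) (cs : seq (rel * seq nat)).

Local Notation word := (seq (rel + bool)).

Definition name_word i : word := rcons (nseq i (inr true)) (inr false).

Definition names_word (js : seq nat) : word := flatten (map name_word js).

Definition constraint_word c : word := inl c.1 :: names_word c.2.

Definition body_word cs : word := flatten (map constraint_word cs).

Definition instance_word n cs : word := name_word n ++ body_word cs.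

Variable ar : rel -> nat.

Definition well_formed n cs : bool :=
  all (fun c => (size c.2 == ar c.1) && all (fun i => i < n) c.2) cs.

(** A separator ends each name, and the length of the scope is fixed by the relation
    symbol in front of it: hence the encoding is uniquely readable. *)
Lemma name_word_inj i j (r s : word) :
  name_word i ++ r = name_word j ++ s -> i = j /\ r = s.
Proof.
by elim: i j => [|i IHi] [|j] //= [] => [|/IHi[-> ->]].
Qed.

Lemma names_word_inj js ks (r s : word) : size js = size ks ->
  names_word js ++ r = names_word ks ++ s -> js = ks /\ r = s.
Proof.
elim: js ks => [|j js IHjs] [|k ks] //= [sz].
by rewrite /names_word /= -!catA => /name_word_inj[-> /(IHjs _ sz)[-> ->]].
Qed.

Lemma instance_word_inj n cs n' cs' : well_formed n cs -> well_formed n' cs' ->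
  instance_word n cs = instance_word n' cs' -> n = n' /\ cs = cs'.
Proof.
move=> wf wf' /name_word_inj[nn]; rewrite -{}nn in wf' *; split=> //.
elim: cs cs' wf wf' b => [|[R js] cs IHcs] [|[R' js'] cs'] //=.
move=> /andP[/andP[/eqP sz _] wf] /andP[/andP[/eqP sz' _] wf'] [RR].
rewrite -{}RR in sz' *.
move/names_word_inj; rewrite -/(body_word cs) -/(body_word cs').
by rewrite sz sz' => -[] // -> /(IHcs _ wf wf') ->.
Qed.

(** The ways in which a word fails to begin with the name of one of [n] variables,
    as seen by a device that counts tallies: the count reaches [n], or the run of
    tallies is cut short by a relation symbol or the end of the word. *)
Definition bad_name n (r : word) : Prop :=
  exists i s, r = nseq i (inr true) ++ s /\
    (i = n \/ i < n /\ forall b s', s <> inr b :: s').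

Lemma name_cases n r :
  (exists i s, i < n /\ r = name_word i ++ s) \/ bad_name n r.
Proof.
elim: n r => [|n IHn] r; first by right; exists 0, r; split=> //; left.
case: r => [|[R|[|]] r]; first by right; exists 0, [::]; split=> //; right.
- by right; exists 0, (inl R :: r); split=> //; right.
- case: (IHn r) => [[i [s [lt ->]]]|[i [s [-> bad]]]].
    by left; exists i.+1, s.
  right; exists i.+1, s; split=> //.
  by case: bad => [->|[lt bad]]; [left | right].
by left; exists 0, r.
Qed.

Lemma names_cases n k r : exists js s,
  [/\ r = names_word js ++ s, all (fun i => i < n) js
    & size js = k \/ size js < k /\ bad_name n s].
Proof.
elim: k r => [|k IHk] r; first by exists [::], r; split=> //; left.
case: (name_cases n r) => [[i [s [lt ->]]]|bad].
  have [js [s' [-> alln szs]]] := IHk s.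
  exists (i :: js), s'; split; rewrite /= ?lt //; first by rewrite /names_word /= catA.
  by case: szs => [->|[? ?]]; [left | right].
by exists [::], r; split=> //; right.
Qed.

Definition bad_body n (r : word) : Prop :=
  (exists b s, r = inr b :: s) \/
  (exists R js s, [/\ r = inl R :: names_word js ++ s, all (fun i => i < n) js,
                      size js < ar R & bad_name n s]).

(** The first error in a word comes after a well-formed list of constraints, which
    a device reading from left to right handles as if the word were correct. *)
Lemma body_cases n r : exists cs s,
  [/\ r = body_word cs ++ s, well_formed n cs & s = [::] \/ bad_body n s].
Proof.
have [k] := ubnP (size r); elim: k r => // k IHk [|[R|b] r] /= szr.
- by exists [::], [::]; split=> //; left.
- have [js [s [rE alln szs]]] := names_cases n (ar R) r.
  case: szs => [szs|[lts bad]]; last first.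
    exists [::], (inl R :: r); split=> //; right; right.
    by exists R, js, s; rewrite rE.
  have szr' : size s < k by move: szr; rewrite rE size_cat; lia.
  have [cs [s' [sE wf bad]]] := IHk _ szr'.
  exists ((R, js) :: cs), s'; split=> //; last by rewrite /= szs eqxx alln.
  by rewrite rE sE /body_word /= /constraint_word /= -!catA.
by exists [::], (inr b :: r); split=> //; right; left; exists b, r.
Qed.

Lemma header_cases (r : word) :
  (exists n s, r = name_word n ++ s) \/
  (exists n s, r = nseq n (inr true) ++ s /\ forall b s', s <> inr b :: s').
Proof.
case: (name_cases (size r).+1 r) => [[n [s [_ ->]]]|[n [s [rE bad]]]].
  by left; exists n, s.
right; exists n, s; split=> //; case: bad => [nE|[] //].
by move: (congr1 size rE); rewrite size_cat size_nseq nE; lia.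
Qed.

End Words.

(** * A transducer for arc consistency *)

(** [Start] and [Header] set up the tape of labels from the number of variables.
    [Visit] reads the names of one constraint; after each name, [Home] brings the
    head of the label tape back to the first label.  [Back] returns to the beginning
    of the current constraint, and [Rewind] to the beginning of the whole list of
    constraints. *)
Inductive phase := Start | Header | Home | Visit | Back | Rewind | Done | Fail.

Definition phase_code (p : phase) : nat :=
  match p with
  | Start => 0 | Header => 1 | Home => 2 | Visit => 3
  | Back => 4 | Rewind => 5 | Done => 6 | Fail => 7
  end.

Definition phases := [:: Start; Header; Home; Visit; Back; Rewind; Done; Fail].

Lemma phase_codeK : pcancel phase_code (onth phases).
Proof. by case. Qed.

HB.instance Definition _ := Countable.copy phase (pcan_type phase_codeK).

Fact phases_enum : Finite.axiom phases.
Proof. by case. Qed.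

HB.instance Definition _ := isFinite.Build phase phases_enum.

(** What is known about the current pass: no label has changed so far, some label
    has changed, or all the labels are known to be final and the output is being
    written. *)
Inductive status := Stable | Changed | Emitting.

Definition status_code (s : status) : option bool :=
  match s with Stable => Some true | Changed => Some false | Emitting => None end.

Definition status_decode (o : option bool) : status :=
  match o with Some true => Stable | Some false => Changed | None => Emitting end.

Lemma status_codeK : cancel status_code status_decode.
Proof. by case. Qed.

HB.instance Definition _ := Finite.copy status (can_type status_codeK).

Section Propagation.
Variables (rel rel' T : finType) (ar : rel -> nat) (K : nat).
Hypothesis arK : forall R, ar R <= K.
Implicit Types (V : {set T}) (ds b fs : seq {set T}) (o : option rel).

(** A label is a set of values still allowed for a variable.  From the labels [b] of
    the variables in the scope of a constraint with symbol [R], [prune R b] computes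
    the bounds to be imposed on these variables, and [relabel R b] the symbol that
    replaces [R] in the output. *)
Variable prune : rel -> seq {set T} -> seq {set T}.
Variable relabel : rel -> seq {set T} -> rel'.
Hypothesis size_prune : forall R b, size b = ar R -> size (prune R b) = ar R.

Arguments nwrite : simpl never.
Arguments zipper : simpl never.

Local Notation letter := (rel + bool)%type.
Local Notation letter' := (rel' + bool)%type.
Local Notation tally := (inr true).
Local Notation separator := (inr false).
Local Notation work := (option {set T}).
Local Notation cell := (letter + work)%type.
Local Notation marker := (inr None).
Local Notation label V := (inr (Some V)).
Local Notation control := (phase * option rel * K.-bseq {set T} * status)%type.
Local Notation act := (option cell * move)%type.

(** The control state.  In phase [Visit] a constraint is read twice.  On the first
    reading [o] is [Some R] and the buffer [b] collects the labels of the variables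
    met so far; on the second one [o] is [None] and [b] lists the bounds still to be
    imposed.  With [o] equal to [None] and [b] empty, the head is at the beginning of
    a constraint or at the end of the input.  The bound on the size of [b] keeps the
    set of states finite. *)
Definition ctl p o b s : control := (p, o, insub_bseq K b, s).

Definition emitted o s (w : seq letter') : seq letter' :=
  if (o : option rel, s) is (None, Emitting) then w else [::].

(** The effect of reaching a variable with label [V]: the new buffer, label and
    status. *)
Definition visit o (b : seq {set T}) s (V : {set T}) : seq {set T} * {set T} * status :=
  if (o : option rel) is Some _ then (rcons b V, V, s)
  else (behead b, V :&: head setT b, if V \subset head setT b then s else Changed).

Definition result : Type := (control * act * act * option letter')%type.

Definition propagate_visit o b s (x d : option cell) : result :=
  match x, d with
  | Some (inl tally), Some (label _) =>
      (ctl Visit o b s, (x, MoveRight), (d, MoveRight), ohead (emitted o s [:: tally]))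
  | Some (inl separator), Some (label V) =>
      let: (b', V', s') := visit o b s V in
      (ctl Home o b' s', (x, MoveRight), (Some (label V'), Stay),
       ohead (emitted o s [:: separator]))
  | _, _ => (ctl Fail None [::] s, (x, Stay), (d, Stay), None)
  end.

(** The separator behind the header is overwritten by a marker, which is what
    [Rewind] looks for; the marker on the label tape is in front of the labels.
    [Back] looks for a relation symbol, so the step that leads to it has to move the
    head off the symbol of the following constraint. *)
Definition propagate p o b s (x d : option cell) : result :=
  match p with
  | Start => (ctl Header None [::] Stable, (x, Stay), (Some marker, MoveRight), None)
  | Header =>
      match x with
      | Some (inl tally) =>
          (ctl Header None [::] Stable, (x, MoveRight),
           (Some (label setT), MoveRight), Some tally)
      | Some (inl separator) =>
          (ctl Home None [::] Stable, (Some marker, MoveRight), (d, Stay),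
           Some separator)
      | _ => (ctl Fail None [::] s, (x, Stay), (d, Stay), None)
      end
  | Home =>
      if d == Some marker then (ctl Visit o b s, (x, Stay), (d, MoveRight), None)
      else (ctl Home o b s, (x, Stay), (d, MoveLeft), None)
  | Visit =>
      match o with
      | Some R =>
          if size b == ar R then
            (ctl Back None (prune R b) s, (x, MoveLeft), (d, Stay),
             ohead (emitted None s [:: inl (relabel R b)]))
          else propagate_visit o b s x d
      | None =>
          if b is [::] then
            match x with
            | Some (inl (inl R)) =>
                (ctl Visit (Some R) [::] s, (x, MoveRight), (d, Stay), None)
            | None =>
                (match s with
                 | Stable => ctl Rewind None [::] Emitting
                 | Changed => ctl Rewind None [::] Stable
                 | Emitting => ctl Done None [::] s
                 end, (x, MoveLeft), (d, Stay), None)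
            | _ => (ctl Fail None [::] s, (x, Stay), (d, Stay), None)
            end
          else propagate_visit o b s x d
      end
  | Back =>
      if x is Some (inl (inl R)) then (ctl Visit o b s, (x, MoveRight), (d, Stay), None)
      else (ctl Back o b s, (x, MoveLeft), (d, Stay), None)
  | Rewind =>
      if x is Some marker then (ctl Visit o b s, (x, MoveRight), (d, Stay), None)
      else (ctl Rewind o b s, (x, MoveLeft), (d, Stay), None)
  | Done | Fail => (ctl p o b s, (x, Stay), (d, Stay), None)
  end.

Definition propagator : transducer letter letter' :=
  @Transducer letter letter' control work (ctl Start None [::] Stable)
    (fun q => q.1.1.1 == Done) (fun q => q.1.1.1 == Fail)
    (fun q => let: (p, o, b, s) := q in propagate p o b s).

Local Notation run := (reach (@tstep _ _ propagator)).

Lemma propagatorE p o b s X D (out : seq letter') :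
  size b <= K -> p != Done -> p != Fail ->
  @tstep _ _ propagator (ctl p o b s, X, D, out) =
  let: (q', aX, aD, e) := propagate p o b s (head_cell X) (head_cell D) in
  (q', nwrite X aX, nwrite D aD, out ++ seq_of_opt e).
Proof.
move=> szb nD nF; rewrite /tstep /= (negbTE nD) (negbTE nF) /=.
by rewrite /insub_bseq val_insubd szb.
Qed.

Lemma emitted_opt o s a : seq_of_opt (ohead (emitted o s [:: a])) = emitted o s [:: a].
Proof. by case: o s => [R|] []. Qed.

Definition letters (w : seq letter) : seq cell := map inl w.

(** The label tape with its head on the label of the variable [j]. *)
Definition labels (ds : seq {set T}) j : tape cell :=
  zipper (rev [seq label V | V <- take j ds] ++ [:: marker])
         [seq label V | V <- drop j ds].

Lemma labels_left ds j : j < size ds ->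
  nwrite (labels ds j.+1) (head_cell (labels ds j.+1), MoveLeft) = labels ds j.
Proof.
move=> lt; rewrite /labels (take_nth set0) // map_rcons rev_rcons cat_cons.
by rewrite (drop_nth set0 lt) -[RHS]zipper_left.
Qed.

Lemma labels_right ds j : j < size ds ->
  nwrite (labels ds j) (head_cell (labels ds j), MoveRight) = labels ds j.+1.
Proof.
move=> lt; rewrite /labels (take_nth set0) // map_rcons rev_rcons cat_cons.
by rewrite (drop_nth set0 lt) [LHS]zipper_right.
Qed.

Lemma labels_head ds j : j < size ds ->
  head_cell (labels ds j) = Some (label (nth set0 ds j)).
Proof. by move=> lt; rewrite /labels (drop_nth set0 lt). Qed.

Lemma labels_end ds : head_cell (labels ds (size ds)) = None.
Proof. by rewrite /labels drop_size. Qed.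

Lemma labels_write ds j V : j < size ds ->
  nwrite (labels ds j) (Some (label V), Stay) = labels (set_nth set0 ds j V) j.
Proof.
move=> lt; rewrite /labels set_nthE lt (drop_nth set0 lt).
rewrite take_cat drop_cat size_takel ?(ltnW lt) // ltnn subnn take0 drop0 cats0.
by rewrite [LHS]zipper_put.
Qed.

Lemma labels0 ds :
  nwrite (zipper [::] (marker :: [seq label V | V <- ds])) (Some marker, MoveRight)
  = labels ds 0.
Proof. by rewrite zipper_right /labels take0 drop0. Qed.

Lemma home_run o b s X ds j (out : seq letter') : size b <= K -> j <= size ds ->
  run j.+2 (ctl Home o b s, X, labels ds j, out) (ctl Visit o b s, X, labels ds 0, out).
Proof.
move=> szb; elim: j => [|j IHj] lej; apply: reach_step; rewrite propagatorE //=.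
  have -> : (head_cell (labels ds 0) == Some (marker : cell)) = false.
    by rewrite /labels; case: (ds).
  rewrite nwrite_stay cats0.
  have -> : nwrite (labels ds 0) (head_cell (labels ds 0), MoveLeft)
      = zipper [::] (marker :: [seq label V | V <- ds]).
    by rewrite /labels take0 drop0 [LHS]zipper_left.
  have := reach1 (@tstep _ _ propagator)
    (ctl Home o b s, X, zipper [::] (marker :: [seq label V | V <- ds]), out).
  by rewrite propagatorE //= labels0 nwrite_stay cats0.
have -> : (head_cell (labels ds j.+1) == Some (marker : cell)) = false.
  have [lt|] := ltnP j.+1 (size ds); first by rewrite labels_head.
  move=> ge; have -> : j.+1 = size ds by apply/eqP; rewrite eqn_leq lej.
  by rewrite labels_end.
by rewrite nwrite_stay labels_left // cats0; apply: IHj; apply: ltnW.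
Qed.

(** The common form of [Back] and [Rewind]; the first move to the left belongs to
    the step that enters the loop. *)
Lemma seek_left (q q' : control) (stop : pred cell) c l r w D (out : seq letter') :
  (forall x d, propagator.(tdelta) q x d =
    if (if x is Some a then stop a else false) then (q', (x, MoveRight), (d, Stay), None)
    else (q, (x, MoveLeft), (d, Stay), None)) ->
  q.1.1.1 != Done -> q.1.1.1 != Fail -> stop c -> all (predC stop) w ->
  run (size w).+1
    (q, nwrite (zipper (rev w ++ c :: l) r) (ohead r, MoveLeft), D, out)
    (q', zipper (c :: l) (w ++ r), D, out).
Proof.
move=> qE nD nF stopc; elim/last_ind: w r => [|w a IHw] r nstop.
  apply: reach_step; rewrite /= zipper_left (negbTE nD) (negbTE nF) /=.
  have := qE (Some c) (head_cell D) => /= ->; rewrite stopc zipper_right nwrite_stay cats0.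
  exact: reach0.
move: nstop; rewrite all_rcons => /andP[/negbTE /= na nw].
rewrite size_rcons; apply: reach_step.
rewrite rev_rcons cat_cons zipper_left /= (negbTE nD) (negbTE nF) /=.
have := qE (Some a) (head_cell D) => /= ->; rewrite na nwrite_stay cats0.
rewrite cat_rcons; exact: IHw.
Qed.

Definition pending o (b : seq {set T}) :=
  if (o : option rel) is Some R then size b != ar R else b != [::].

Lemma pending_visit o b s x d :
  pending o b -> propagate Visit o b s x d = propagate_visit o b s x d.
Proof. by case: o b => [R|] [|V b] //= /negbTE ->. Qed.

Lemma tallies_run o b s l r ds i j (out : seq letter') :
  size b <= K -> pending o b -> i + j <= size ds ->
  run i (ctl Visit o b s, zipper l (letters (nseq i tally ++ r)), labels ds j, out)
    (ctl Visit o b s, zipper (rev (letters (nseq i tally)) ++ l) (letters r),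
     labels ds (i + j), out ++ emitted o s (nseq i tally)).
Proof.
move=> szb pb; elim: i j l out => [|i IHi] j l out le.
  have -> : emitted o s [::] = [::] by case: (o) (s) => [?|] [].
  by rewrite cats0; apply: reach0.
apply: reach_step; rewrite propagatorE // pending_visit // labels_head /=; last by lia.
rewrite zipper_right -(labels_head (j := j)) ?labels_right; try lia.
rewrite emitted_opt addSnnS rev_cons cat_rcons.
have -> : out ++ emitted o s (tally :: nseq i tally)
   = (out ++ emitted o s [:: tally]) ++ emitted o s (nseq i tally).
  by rewrite -catA; case: (o) (s) => [?|] [].
by apply: IHi; lia.
Qed.

(** The head of the label tape moves along with the tallies and so ends up on the
    label of the variable; the cost is linear in the length of the name, as going home takes as
    long as coming. *)
Lemma name_run o b s l r ds i (out : seq letter')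
    (v := visit o b s (nth set0 ds i)) :
  size b <= K -> size v.1.1 <= K -> pending o b -> i < size ds ->
  run (3 * size (name_word rel i))
    (ctl Visit o b s, zipper l (letters (name_word rel i ++ r)), labels ds 0, out)
    (ctl Visit o v.1.1 v.2, zipper (rev (letters (name_word rel i)) ++ l) (letters r),
     labels (set_nth set0 ds i v.1.2) 0, out ++ emitted o s (name_word rel' i)).
Proof.
move=> szb szv pb lt.
apply: (@reach_leq _ _ (i + (1 + i.+2))); last by rewrite size_rcons size_nseq; lia.
rewrite /name_word cat_rcons.
apply: reach_trans (tallies_run _ _ _ _ _ _ _) _; rewrite ?addn0 ?(ltnW lt) //.
apply: reach_trans (reach1 _ _) _.
rewrite propagatorE // pending_visit // labels_head //=.
rewrite -/v; case vE: v szv => [[b' V'] s'] /= szv.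
rewrite zipper_right labels_write // emitted_opt.
have -> : rev (letters (rcons (nseq i tally) separator)) ++ l =
    inl separator :: rev (letters (nseq i tally)) ++ l.
  by rewrite /letters map_rcons rev_rcons.
have -> : out ++ emitted o s (rcons (nseq i tally) separator) =
   (out ++ emitted o s (nseq i tally)) ++ emitted o s [:: separator].
  by rewrite -catA; case: (o) (s) => [?|] []; rewrite //= cats1.
apply: home_run => //; rewrite size_set_nth; lia.
Qed.

Lemma rev_letters_cat u v l :
  rev (letters (u ++ v)) ++ l = rev (letters v) ++ rev (letters u) ++ l.
Proof. by rewrite /letters map_cat rev_cat -catA. Qed.

Lemma set_nth_same (ds : seq {set T}) i : i < size ds ->
  set_nth set0 ds i (nth set0 ds i) = ds.
Proof.
move=> lt; apply: (@eq_from_nth _ set0) => [|j ltj].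
  by rewrite size_set_nth; apply/maxn_idPr.
by rewrite nth_set_nth /=; case: eqP => [->|].
Qed.

Lemma collect_run R b s l r ds js (out : seq letter') :
  size b + size js <= ar R -> all (fun i => i < size ds) js ->
  run (3 * size (names_word rel js))
    (ctl Visit (Some R) b s, zipper l (letters (names_word rel js ++ r)), labels ds 0, out)
    (ctl Visit (Some R) (b ++ [seq nth set0 ds i | i <- js]) s,
     zipper (rev (letters (names_word rel js)) ++ l) (letters r), labels ds 0, out).
Proof.
elim: js b l => [|i js IHjs] b l /=; first by rewrite cats0 => _ _; apply: reach0.
move=> szb /andP[lt ltjs]; rewrite /names_word /= -/(names_word rel js).
rewrite -catA size_cat mulnDr; have leK := arK R.
apply: reach_trans (name_run _ _ _ _ _ _ _) _; rewrite ?size_rcons //=; try lia.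
rewrite set_nth_same // cats0 rev_letters_cat -cat_rcons.
by apply: IHjs => //; rewrite size_rcons; lia.
Qed.

Definition within (ds : seq {set T}) (env : nat -> T) : Prop :=
  forall i, i < size ds -> env i \in nth set0 ds i.

(** The measure that a pass that changes anything must decrease. *)
Definition weight (ds : seq {set T}) := sumn [seq #|V| | V : {set T} <- ds].

Lemma weight_set_nth ds i V : i < size ds -> V \proper nth set0 ds i ->
  weight (set_nth set0 ds i V) < weight ds.
Proof.
rewrite /weight; elim: ds i => [|W ds IHds] [|i] //= lt.
  by move/proper_card; rewrite ltn_add2r.
by move=> /(IHds _ lt); rewrite ltn_add2l.
Qed.

(** No bound [fs] cuts down the label of its variable. *)
Definition fits (ds : seq {set T}) (js : seq nat) (fs : seq {set T}) :=
  all2 (fun i V => nth set0 ds i \subset V) js fs.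

Definition member (env : nat -> T) (js : seq nat) (fs : seq {set T}) :=
  all2 (fun i V => env i \in V) js fs.

(** Either nothing happens, and then the bounds hold already, or the weight drops;
    in both cases no assignment that satisfies the bounds is lost.  A variable that
    occurs twice in the scope is met twice, which does no harm, since labels are
    intersected with the bounds instead of being replaced by them. *)
Lemma walk_run s l r ds js fs (out : seq letter') :
  s != Emitting -> size fs <= K -> size fs = size js ->
  all (fun i => i < size ds) js ->
  exists s' ds',
  [/\ run (3 * size (names_word rel js))
        (ctl Visit None fs s, zipper l (letters (names_word rel js ++ r)), labels ds 0, out)
        (ctl Visit None [::] s', zipper (rev (letters (names_word rel js)) ++ l) (letters r),
         labels ds' 0, out),
      s' != Emitting, size ds' = size ds,
      [/\ s' = s, ds' = ds & fits ds js fs] \/ (s' = Changed /\ weight ds' < weight ds)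
    & forall env, within ds env -> member env js fs -> within ds' env].
Proof.
move=> nE; elim: js fs s nE l ds => [|i js IHjs] [|V fs] //= s nE l ds.
  by exists s, ds; split=> //; [apply: reach0 | left].
move=> leK [szfs] /andP[lt ltjs].
set W := nth set0 ds i :&: V.
set s1 := if nth set0 ds i \subset V then s else Changed.
have nE1 : s1 != Emitting by rewrite /s1; case: ifP.
set ds1 := set_nth set0 ds i W.
have sz1 : size ds1 = size ds by rewrite size_set_nth; apply/maxn_idPr.
have [|s' [ds' [run' nE' sz' prog sound]]] :=
  IHjs fs s1 nE1 (rev (letters (name_word rel i)) ++ l) ds1 (ltnW leK) szfs.
  by rewrite sz1.
exists s', ds'; split=> //; last 2 first.
- have [sub|nsub] := boolP (nth set0 ds i \subset V).
    have dsE : ds1 = ds by rewrite /ds1 /W (setIidPl sub) set_nth_same.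
    by move: prog; rewrite /s1 sub dsE => -[[-> -> ->]|]; [left | right].
  have lt1 : weight ds1 < weight ds.
    by apply: weight_set_nth => //; rewrite properE subsetIl subsetI subxx.
  right; case: prog => [[-> -> _]|[-> lt2]]; last by split=> //; apply: ltn_trans lt1.
  by rewrite /s1 (negbTE nsub).
- move=> env wenv /andP[inV mem]; apply: sound => // j; rewrite sz1 => ltj.
  rewrite nth_set_nth /=; case: eqP => [->|_]; last exact: wenv.
  by rewrite inE wenv.
- rewrite /names_word /= -/(names_word rel js) -catA size_cat mulnDr.
  have noem w : emitted None s w = [::] by case: (s) nE.
  apply: reach_trans (name_run _ _ _ _ _ _ _) _ => //=; first exact: ltnW.
  by rewrite noem cats0 rev_letters_cat; apply: run'.
- by rewrite sz' sz1.
Qed.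

Lemma walk_emit l r ds js fs (out : seq letter') :
  size fs <= K -> size fs = size js -> all (fun i => i < size ds) js ->
  fits ds js fs ->
  run (3 * size (names_word rel js))
    (ctl Visit None fs Emitting, zipper l (letters (names_word rel js ++ r)), labels ds 0, out)
    (ctl Visit None [::] Emitting, zipper (rev (letters (names_word rel js)) ++ l) (letters r),
     labels ds 0, out ++ names_word rel' js).
Proof.
elim: js fs l out => [|i js IHjs] [|V fs] //= l out.
  by rewrite cats0 => *; apply: reach0.
move=> leK [szfs] /andP[lt ltjs] /andP[sub fit].
rewrite /names_word /= -/(names_word rel js) -/(names_word rel' js) -catA size_cat mulnDr.
apply: reach_trans (name_run _ _ _ _ _ _ _) _ => //=; first exact: ltnW.
rewrite sub (setIidPl sub) set_nth_same // rev_letters_cat (catA out).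
by apply: IHjs => //; apply: ltnW.
Qed.

Definition pruned ds (c : rel * seq nat) := prune c.1 [seq nth set0 ds i | i <- c.2].

(** The first reading of a constraint, up to the moment when the bounds are known
    and the head is back on the first name. *)
Lemma approach_run R js s l r ds (out : seq letter') :
  size js = ar R -> all (fun i => i < size ds) js ->
  run (4 * size (names_word rel js) + 3)
    (ctl Visit None [::] s, zipper l (letters (constraint_word (R, js) ++ r)),
     labels ds 0, out)
    (ctl Visit None (pruned ds (R, js)) s,
     zipper (inl (inl R) :: l) (letters (names_word rel js ++ r)), labels ds 0,
     out ++ emitted None s [:: inl (relabel R [seq nth set0 ds i | i <- js])]).
Proof.
move=> szjs ltjs; set b := [seq nth set0 ds i | i <- js]; have leK := arK R.
have szb : size b = ar R by rewrite size_map.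
set m := size (names_word rel js).
apply: (@reach_leq _ _ (1 + (3 * m + (1 + m.+1)))); last by lia.
apply: reach_trans (reach1 _ _) _.
rewrite propagatorE //= zipper_right nwrite_stay cats0.
apply: reach_trans (collect_run _ _ _ _ _ _) _; rewrite ?szjs //= -/b.
apply: reach_trans (reach1 _ _) _.
rewrite propagatorE /= ?szb ?eqxx // emitted_opt nwrite_stay.
have -> : m = size (letters (names_word rel js)) by rewrite size_map.
rewrite /letters map_cat -/(letters _).
apply: (@seek_left _ _ (fun a => if a is inl (inl _) then true else false)) => //.
- move=> x d; rewrite /= /insub_bseq val_insubd size_prune // leK.
  by case: x => [[[?|?]|?]|].
- rewrite /letters /names_word all_map; elim: (js) => //= i js' IH.
  by rewrite all_cat IH andbT /name_word all_rcons /= all_nseq /= orbT.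
Qed.

Definition stable ds c := fits ds c.2 (pruned ds c).

(** Pruning by [c] never loses such an assignment; solutions of the constraint [c]
    are the intended case. *)
Definition compatible (env : nat -> T) (c : rel * seq nat) : Prop :=
  forall b, member env c.2 b -> member env c.2 (prune c.1 b).

Local Notation wf := (well_formed ar).

Lemma within_member ds env js : within ds env -> all (fun i => i < size ds) js ->
  member env js [seq nth set0 ds i | i <- js].
Proof. by move=> w; elim: js => //= i js IHjs /andP[lt /IHjs]; rewrite w. Qed.

(** The word [r] behind the constraints is arbitrary, so that the lemma also covers
    the part of a malformed word that precedes the first error. *)
Lemma pass_run cs s l r ds (out : seq letter') :
  s != Emitting -> wf (size ds) cs ->
  exists s' ds',
  [/\ run (7 * size (body_word cs))
        (ctl Visit None [::] s, zipper l (letters (body_word cs ++ r)), labels ds 0, out)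
        (ctl Visit None [::] s', zipper (rev (letters (body_word cs)) ++ l) (letters r),
         labels ds' 0, out),
      s' != Emitting, size ds' = size ds,
      [/\ s' = s, ds' = ds & all (stable ds) cs] \/ (s' = Changed /\ weight ds' < weight ds)
    & forall env, (forall c, c \in cs -> compatible env c) -> within ds env -> within ds' env].
Proof.
elim: cs s l ds => [|[R js] cs IHcs] s l ds nE /=.
  by exists s, ds; split=> //; [apply: reach0 | left].
move=> /andP[/andP[/eqP szjs ltjs] wfcs].
rewrite /body_word /= -/(body_word cs).
have szp : size (pruned ds (R, js)) = ar R by rewrite size_prune // size_map.
have [] := @walk_run s (inl (inl R) :: l) (body_word cs ++ r) ds js (pruned ds (R, js)) out nE.
- by rewrite szp.
- by rewrite szp szjs.
- by [].
move=> s1 [ds1 [run1 nE1 sz1 prog1 sound1]].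
have wf1 : wf (size ds1) cs by rewrite sz1.
have [s2 [ds2 [run2 nE2 sz2 prog2 sound2]]] :=
  IHcs s1 (rev (letters (constraint_word (R, js))) ++ l) ds1 nE1 wf1.
exists s2, ds2; split=> //; last 2 first.
- case: prog1 => [[s1E ds1E st]|[s1E lt1]].
    rewrite ds1E s1E in prog2; case: prog2 => [[-> -> ->]|]; last by right.
    by left; rewrite /stable st.
  right; case: prog2 => [[-> -> _]|[-> lt2]] //; split=> //; exact: ltn_trans lt1.
- move=> env comp wenv; apply: sound2 => [c cin|]; first by apply: comp; rewrite inE cin orbT.
  apply: sound1 => //; apply: (comp (R, js)); first by rewrite inE eqxx.
  exact: within_member.
- rewrite size_cat /=; set m := size (names_word rel js).
  apply: (@reach_leq _ _ (4 * m + 3 + (3 * m + 7 * size (body_word cs)))); last by lia.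
  rewrite -catA; apply: reach_trans (approach_run _ _ _ _ _ _) _ => //.
  have -> : emitted None s [:: inl (relabel R [seq nth set0 ds i | i <- js])] = [::].
    by case: (s) nE.
  rewrite cats0; apply: reach_trans run1 _.
  rewrite -[inl (inl R) :: letters _]/(letters (constraint_word (R, js) ++ body_word cs)).
  move: run2; rewrite rev_letters_cat; congr (reach _ _ (_, zipper _ _, _, _) _).
  by rewrite /= rev_cons cat_rcons.
- by rewrite sz2.
Qed.

Definition relabelled ds (c : rel * seq nat) : rel' * seq nat :=
  (relabel c.1 [seq nth set0 ds i | i <- c.2], c.2).

(** Since the labels are stable, the second reading does not change them, and every
    constraint is translated with respect to the same labels. *)
Lemma emit_run cs l r ds (out : seq letter') :
  wf (size ds) cs -> all (stable ds) cs ->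
  run (7 * size (body_word cs))
    (ctl Visit None [::] Emitting, zipper l (letters (body_word cs ++ r)), labels ds 0, out)
    (ctl Visit None [::] Emitting, zipper (rev (letters (body_word cs)) ++ l) (letters r),
     labels ds 0, out ++ body_word (map (relabelled ds) cs)).
Proof.
elim: cs l out => [|[R js] cs IHcs] l out /=.
  by rewrite cats0 => *; apply: reach0.
move=> /andP[/andP[/eqP szjs ltjs] wfcs] /andP[st stcs].
rewrite /body_word /= -/(body_word cs) -/(body_word (map _ cs)).
have szp : size (pruned ds (R, js)) = ar R by rewrite size_prune // size_map.
rewrite size_cat /=; set m := size (names_word rel js).
apply: (@reach_leq _ _ (4 * m + 3 + (3 * m + 7 * size (body_word cs)))); last by lia.
rewrite -catA; apply: reach_trans (approach_run _ _ _ _ _ _) _ => //=.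
apply: reach_trans (walk_emit _ _ _ _ _ _ _) _ => //; rewrite ?szp //.
have := IHcs (rev (letters (constraint_word (R, js))) ++ l)
  (out ++ constraint_word (relabelled ds (R, js))) wfcs stcs.
rewrite -[inl (inl R) :: letters _]/(letters (constraint_word (R, js) ++ body_word cs)).
rewrite rev_letters_cat -!catA; congr (reach _ _ (_, zipper _ _, _, _) _).
by rewrite /= rev_cons cat_rcons.
Qed.

Lemma rewind_run s l w ds (out : seq letter') :
  run (size w).+2
    (ctl Visit None [::] s, zipper (rev (letters w) ++ marker :: l) [::], labels ds 0, out)
    (match s with
     | Stable => ctl Visit None [::] Emitting
     | Changed => ctl Visit None [::] Stable
     | Emitting => ctl Done None [::] s
     end,
     if s is Emitting
     then nwrite (zipper (rev (letters w) ++ marker :: l) [::]) (None, MoveLeft)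
     else zipper (marker :: l) (letters w),
     labels ds 0, out).
Proof.
apply: reach_step; rewrite propagatorE //= nwrite_stay cats0.
have seek s' : run (size w).+1
    (ctl Rewind None [::] s',
     nwrite (zipper (rev (letters w) ++ marker :: l) [::]) (None, MoveLeft), labels ds 0, out)
    (ctl Visit None [::] s', zipper (marker :: l) (letters w), labels ds 0, out).
  have := @seek_left (ctl Rewind None [::] s') (ctl Visit None [::] s')
    (fun a => if a is marker then true else false) marker l [::] (letters w)
    (labels ds 0) out.
  rewrite size_map cats0; apply=> //; last by rewrite all_map; apply/allP.
  by move=> x d; rewrite /= /insub_bseq val_insubd; case: x => [[?|[?|]]|].
by case: s; [apply: seek | apply: seek | apply: reach_leq (reach0 _ _) _].
Qed.

(** By induction on the weight of the labels. *)
Lemma loop_run cs l ds (out : seq letter') : wf (size ds) cs ->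
  exists ds',
  [/\ run ((weight ds).+1 * (8 * size (body_word cs) + 2))
        (ctl Visit None [::] Stable, zipper (marker :: l) (letters (body_word cs)),
         labels ds 0, out)
        (ctl Visit None [::] Emitting, zipper (marker :: l) (letters (body_word cs)),
         labels ds' 0, out),
      size ds' = size ds, all (stable ds') cs
    & forall env, (forall c, c \in cs -> compatible env c) -> within ds env -> within ds' env].
Proof.
have [k] := ubnP (weight ds); elim: k ds => // k IHk ds ltk wfcs.
have [s1 [ds1 [run1 nE1 sz1 prog1 sound1]]] :=
  @pass_run cs Stable (marker :: l) [::] ds out isT wfcs.
rewrite cats0 in run1.
have := reach_trans run1 (@rewind_run s1 l (body_word cs) ds1 out).
case: prog1 => [[-> -> st] run2|[s1E lt1]].
  exists ds; split=> //; apply: reach_leq run2 _; rewrite mulSn.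
  by lia.
rewrite s1E => run2.
have lt2 : weight ds1 < k by apply: leq_trans lt1 _.
have wf1 : wf (size ds1) cs by rewrite sz1.
have [ds' [run3 sz' st' sound']] := IHk ds1 lt2 wf1.
exists ds'; split=> //; last by move=> env comp wenv; apply: sound' => //; apply: sound1.
  apply: reach_leq (reach_trans run2 run3) _.
  set B := _ + 2; have : (weight ds1).+1 * B <= weight ds * B by rewrite leq_mul2r lt1 orbT.
  by rewrite [(weight ds).+1 * _]mulSn {2}/B; lia.
by rewrite sz'.
Qed.

Lemma header_tallies n j r (out : seq letter') l :
  run n
    (ctl Header None [::] Stable, zipper l (letters (nseq n tally ++ r)),
     labels (nseq j setT) j, out)
    (ctl Header None [::] Stable, zipper (rev (letters (nseq n tally)) ++ l) (letters r),
     labels (nseq (n + j) setT) (n + j), out ++ nseq n tally).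
Proof.
elim: n j out l => [|n IHn] j out l; first by rewrite cats0; apply: reach0.
apply: reach_step; rewrite propagatorE //= zipper_right rev_cons cat_rcons.
have -> : nwrite (labels (nseq j setT) j) (Some (label setT), MoveRight)
   = labels (nseq j.+1 setT) j.+1.
  rewrite /labels !take_oversize ?drop_oversize ?size_nseq // zipper_right /=.
  by rewrite -[_ :: map _ _]/(map _ (nseq j.+1 setT)) !map_nseq -[in RHS]addn1 nseqD rev_cat.
rewrite -[_ :: nseq (n + j) _]/(nseq (n.+1 + j) [set: T]) addSnnS.
rewrite -(cat1s tally (nseq n _)) catA.
exact: IHn.
Qed.

Lemma start_run (w : seq letter) :
  run 1 (tinitial propagator w)
    (ctl Header None [::] Stable, zipper [::] (letters w), labels (nseq 0 setT) 0, [::]).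
Proof.
have := reach1 (@tstep _ _ propagator) (tinitial propagator w).
by rewrite /tinitial propagatorE //= nwrite_stay.
Qed.

Lemma header_run n r :
  run (2 * n + 4) (tinitial propagator (name_word rel n ++ r))
    (ctl Visit None [::] Stable, zipper (marker :: rev (letters (nseq n tally))) (letters r),
     labels (nseq n setT) 0, name_word rel' n).
Proof.
apply: (@reach_leq _ _ (1 + (n + (1 + n.+2)))); last by lia.
apply: reach_trans (start_run _) _; rewrite /name_word cat_rcons.
apply: reach_trans (header_tallies _ _ _ _ _) _.
apply: reach_trans (reach1 _ _) _; rewrite propagatorE //= zipper_right nwrite_stay.
rewrite addn0 cats0 cats1; apply: home_run => //; by rewrite size_nseq.
Qed.

(** Each of the at most [n * #|T| + 1] pruning passes takes linear time, and so does
    the pass that writes the output. *)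
Definition time n := (8 * #|T| + 20) * n.+1 ^ 2.

Lemma time_bound n m :
  2 * n + 4 + ((n * #|T|).+1 * (8 * m + 2) + (7 * m + m.+2)) <= time (n.+1 + m).
Proof.
rewrite /time; set t := #|T|; set N := (n.+1 + m).+1.
have le1 : N <= N ^ 2 by rewrite leq_pmulr.
have le2 : n * m + n <= N ^ 2 by rewrite addnC -mulnS leq_mul // /N; lia.
have le3 : t * (n * m + n) <= t * N ^ 2 by rewrite leq_mul2l le2 orbT.
have -> : (n * t).+1 * (8 * m + 2) = 8 * (t * (n * m)) + 2 * (t * n) + 8 * m + 2 by ring.
rewrite mulnDl -mulnA; move: le1 le3; rewrite mulnDr /N; lia.
Qed.

Lemma time_linear n : 20 * n.+1 <= time n.
Proof. by rewrite /time; rewrite leq_mul ?leq_addl ?leq_pmulr. Qed.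

Lemma weight_full n : weight (nseq n setT) = n * #|T|.
Proof. by rewrite /weight map_nseq cardsT sumn_nseq mulnC. Qed.

(** The assignments [env] in the last clause are arbitrary: stable labels contain
    every assignment that satisfies all the constraints. *)
Lemma propagator_done n cs : wf n cs ->
  exists ds X D,
  [/\ run (time (size (instance_word n cs))) (tinitial propagator (instance_word n cs))
        (ctl Done None [::] Emitting, X, D, instance_word n (map (relabelled ds) cs)),
      size ds = n, all (stable ds) cs
    & forall env, (forall c, c \in cs -> compatible env c) -> within ds env].
Proof.
move=> wfcs; have szn : size (nseq n [set: T]) = n by rewrite size_nseq.
have wfn : wf (size (nseq n [set: T])) cs by rewrite szn.
set l := rev (letters (nseq n tally)).
have [ds [run2 szds st sound]] :=
  @loop_run cs l (nseq n setT) (name_word rel' n) wfn.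
have wfd : wf (size ds) cs by rewrite szds szn.
have run3 := @emit_run cs (marker :: l) [::] ds (name_word rel' n) wfd st.
rewrite cats0 in run3.
have run4 := @rewind_run Emitting l (body_word cs) ds
  (name_word rel' n ++ body_word (map (relabelled ds) cs)).
exists ds; do 2!eexists; split; last 3 first.
- by rewrite szds.
- by [].
- move=> env comp; apply: sound => // i; rewrite szn => lt.
  by rewrite nth_nseq lt inE.
have passes := reach_trans run2 (reach_trans run3 run4).
apply: reach_leq (reach_trans (header_run n (body_word cs)) passes) _.
rewrite weight_full /instance_word size_cat size_rcons size_nseq.
exact: time_bound.
Qed.

Lemma fail_run o b s X D (out : seq letter') : size b <= K -> 
  (forall x d, x = head_cell X -> d = head_cell D ->
    propagate Visit o b s x d = (ctl Fail None [::] s, (x, Stay), (d, Stay), None)) ->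
  run 1 (ctl Visit o b s, X, D, out) (ctl Fail None [::] s, X, D, out).
Proof.
move=> szb pE; have := reach1 (@tstep _ _ propagator) (ctl Visit o b s, X, D, out).
by rewrite propagatorE // (pE _ _ erefl erefl) !nwrite_stay cats0.
Qed.

Lemma bad_body_run s l r ds (out : seq letter') : bad_body ar (size ds) r ->
  exists X D out',
  run (3 * size r + 4) (ctl Visit None [::] s, zipper l (letters r), labels ds 0, out)
    (ctl Fail None [::] s, X, D, out').
Proof.
case=> [[b [r' ->]]|[R [js [r' [-> ltjs ltR bad]]]]].
  do 3!eexists; apply: (@reach_leq _ _ 1); last by rewrite /= addnC.
  by apply: fail_run => // x d -> _.
have leK := arK R; set fs := [seq nth set0 ds i | i <- js].
have szfs : size fs = size js by rewrite size_map.
have := reach1 (@tstep _ _ propagator)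
  (ctl Visit None [::] s, zipper l (letters (inl R :: names_word rel js ++ r')),
   labels ds 0, out).
rewrite propagatorE //= zipper_right nwrite_stay cats0 => run1.
have := @collect_run R [::] s (inl (inl R) :: l) r' ds js out (ltnW ltR) ltjs.
move/(reach_trans run1); rewrite cat0s -/fs.
case: bad => i [r2 [-> bad]] run2.
have lei : i + 0 <= size ds by rewrite addn0; case: bad => [->|[/ltnW]].
have pend : pending (Some R) fs by rewrite /= szfs neq_ltn ltR.
have szK : size fs <= K by rewrite szfs; lia.
have run3 := reach_trans run2 (tallies_run s _ _ _ szK pend lei).
do 3!eexists; apply: reach_leq (reach_trans run3 (fail_run _ _ _)) _ => //; last first.
  by rewrite /= !size_cat size_nseq; lia.
move=> x d -> ->; rewrite pending_visit // addn0.
case: bad => [->|[_ bad]].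
  by rewrite labels_end /=; case: (letters r2) => [|[[?|[]]|?] ?].
by case: r2 bad {run2 run3} => [|[?|b] r2] bad //; case: (bad b r2).
Qed.

(** The converse of [propagator_done]: only encodings are accepted.  That a failing
    run is never the run on an encoding follows from determinism. *)
Lemma propagator_cases (w : seq letter) :
  (exists n cs, wf n cs /\ w = instance_word n cs) \/
  (exists s X D out,
     run (time (size w)) (tinitial propagator w) (ctl Fail None [::] s, X, D, out)).
Proof.
have [[n [r ->]]|[n [r [-> bad]]]] := header_cases w; last first.
  right; do 4!eexists; apply: (@reach_leq _ _ (1 + (n + 1))); last first.
    by apply: leq_trans (time_linear _); rewrite size_cat size_nseq; lia.
  apply: reach_trans (start_run _) _.
  apply: reach_trans (header_tallies _ _ _ _ _) _.
  have fails d : propagate Header None [::] Stable (ohead (letters r)) d =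
     (ctl Fail None [::] Stable, (ohead (letters r), Stay), (d, Stay), None).
    by case: r bad => [|[?|b] r] bad //; case: (bad b r).
  have := reach1 (@tstep _ _ propagator) (ctl Header None [::] Stable,
    zipper (rev (letters (nseq n tally)) ++ [::]) (letters r),
    labels (nseq (n + 0) setT) (n + 0), nseq n tally).
  by rewrite propagatorE // fails; apply.
have [cs [s [rE wfcs bad]]] := body_cases ar n r.
case: bad => [sE|bad]; first by left; exists n, cs; rewrite rE sE cats0.
right; have szn : size (nseq n [set: T]) = n by rewrite size_nseq.
have wfn : wf (size (nseq n [set: T])) cs by rewrite szn.
have [s1 [ds [run2 nE1 szds _ _]]] := @pass_run cs Stable
   (marker :: rev (letters (nseq n tally))) s (nseq n setT) (name_word rel' n) isT wfn.
rewrite -rE in run2; rewrite -szn -szds in bad.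
have [X [D [out run3]]] := bad_body_run s1
  (rev (letters (body_word cs)) ++ marker :: rev (letters (nseq n tally)))
  (name_word rel' n) bad.
do 4!eexists; apply: reach_leq (reach_trans (header_run n r) (reach_trans run2 run3)) _.
by apply: leq_trans (time_linear _); rewrite rE !size_cat size_rcons size_nseq; lia.
Qed.

End Propagation.

(** * Instances as words *)

Section Instances.
Variables (A : finType) (Delta : seq (relation A)).

Definition holds (R : relation A) (s : seq A) : bool :=
  [exists u in tagged R, tval u == s].

Lemma holds_tuple (R : relation A) (u : (tag R).-tuple A) : holds R u = (u \in tagged R).
Proof.
apply/exists_inP/idP => [[v vR /eqP /val_inj <-] //|uR]; by exists u.
Qed.

Definition scope_size (R : seq_sub Delta) : nat := tag (val R).

Definition solves (env : nat -> A) (cs : seq (seq_sub Delta * seq nat)) : bool :=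
  all (fun c => holds (val c.1) (map env c.2)) cs.

Definition constraint_data n (C : constraint Delta n) : seq_sub Delta * seq nat :=
  (tag C, [seq nat_of_ord i | i <- tagged C]).

Lemma encodeE (I : instance Delta) :
  encode I = instance_word (nvars I) (map (@constraint_data _) (constraints I)).
Proof.
congr (_ ++ flatten _); rewrite -map_comp; apply: eq_map => C /=.
by rewrite /encode_constraint /constraint_word /names_word /= -map_comp.
Qed.

Lemma constraint_data_wf n (Cs : seq (constraint Delta n)) :
  well_formed scope_size n (map (@constraint_data n) Cs).
Proof.
rewrite /well_formed all_map; apply/allP => C _ /=.
rewrite size_map size_tuple eqxx /= all_map.
by apply/allP => i _ /=.
Qed.

Lemma ordinals_of n (js : seq nat) : all (fun i => i < n) js ->
  exists s : seq 'I_n, [seq nat_of_ord i | i <- s] = js.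
Proof.
elim: js => [|j js IHjs] /=; first by exists [::].
by case/andP=> lt /IHjs[s <-]; exists (Ordinal lt :: s).
Qed.

Lemma constraints_of n cs : well_formed scope_size n cs ->
  exists Cs : seq (constraint Delta n), map (@constraint_data n) Cs = cs.
Proof.
elim: cs => [|[R js] cs IHcs] /=; first by exists [::].
case/andP=> /andP[/eqP szjs /ordinals_of[s sE]] /IHcs[Cs <-].
have szs : size s == tag (val R) by rewrite -(size_map (@nat_of_ord n)) sE szjs.
by exists (existT _ R (Tuple szs) :: Cs); rewrite /= /constraint_data /= sE.
Qed.

Lemma satisfied_data n (env : nat -> A) (f : 'I_n -> A) (C : constraint Delta n) :
  (forall i : 'I_n, env i = f i) ->
  satisfied f C = holds (val (constraint_data C).1) (map env (constraint_data C).2).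
Proof.
move=> envE; rewrite /satisfied -holds_tuple; congr holds.
by rewrite /= -map_comp; apply: eq_map => i /=.
Qed.

Lemma CSP_instance_word (a0 : A) w : CSP w <->
  exists n cs, [/\ well_formed scope_size n cs, w = instance_word n cs
                 & exists env, solves env cs].
Proof.
split=> [[I [-> [f fI]]]|[n [cs [wf -> [env sol]]]]].
  exists (nvars I), (map (@constraint_data _) (constraints I)).
  split; [exact: constraint_data_wf | exact: encodeE | ].
  exists (fun i => oapp f a0 (insub i)); rewrite /solves all_map.
  apply: sub_all fI => C; rewrite (satisfied_data _ (env := fun i => oapp f a0 (insub i))) //.
  by move=> i; rewrite valK.
have [Cs CsE] := constraints_of wf.
exists (Instance Cs); split; first by rewrite encodeE CsE.
exists (fun i => env i); move: sol; rewrite -CsE /solves all_map.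
by apply: sub_all => C; rewrite (satisfied_data _ (env := env)).
Qed.

Definition support (b : seq {set A}) : pred (seq A) :=
  fun r => all2 (fun x (V : {set A}) => x \in V) r b.

(** Arc consistency: the values taken at each place by the tuples of the relation
    that lie in the product of the sets [b]. *)
Definition project (R : seq_sub Delta) (b : seq {set A}) : seq {set A} :=
  mkseq (fun k => [set a | [exists r in tagged (val R),
     support b r && (nth a r k == a)]]) (scope_size R).

Lemma size_project R b : size b = scope_size R -> size (project R b) = scope_size R.
Proof. by rewrite size_mkseq. Qed.

Lemma all2_nth (U V : Type) (P : U -> V -> bool) x y s r : size s = size r ->
  (forall k, k < size s -> P (nth x s k) (nth y r k)) <-> all2 P s r.
Proof.
elim: s r => [|u s IHs] [|v r] //= [sz]; split=> [H|/andP[Puv /IHs H] [|k] //=].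
  by rewrite (H 0) //=; apply/IHs => // k; apply: (H k.+1).
exact: H.
Qed.

Lemma member_map env js (fs : seq {set A}) :
  member env js fs = all2 (fun x (V : {set A}) => x \in V) (map env js) fs.
Proof. by elim: js fs => [|j js IHjs] [|V fs] //=; rewrite -IHjs. Qed.

Lemma holds_compatible env c : holds (val c.1) (map env c.2) -> compatible project env c.
Proof.
case: c => R js /exists_inP[r rR /eqP rE] b; rewrite !member_map /= -rE => mem.
apply/(@all2_nth _ _ _ (env 0) set0); first by rewrite size_mkseq size_tuple.
move=> k; rewrite size_tuple => lt; rewrite nth_mkseq // inE.
apply/exists_inP; exists r => //; rewrite /support mem /=.
by apply/eqP; apply: set_nth_default; rewrite size_tuple.
Qed.

End Instances.

(** * Invariant relations and term operations *)

Lemma eval_ext (S : signature) (A : algebra S) (X : Type) (e e' : X -> A) (t : term S X) :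
  (forall x, e x = e' x) -> eval e t = eval e' t.
Proof.
move=> ee; elim: t => [x|f ts IHts] //=; congr op.
by apply: eq_from_tnth => i; rewrite !tnth_mktuple.
Qed.

Lemma Inv_term (S : signature) (A : fin_algebra S) (R : relation A) (X : Type)
    (u : X -> (tag R).-tuple A) (t : term S X) : Inv R -> (forall x, u x \in tagged R) ->
  [tuple eval (A := A) (fun x => tnth (u x) j) t | j < tag R] \in tagged R.
Proof.
move=> invR uR; elim: t => [x|f ts IHts] /=.
  rewrite (_ : [tuple _ | _ < _] = u x) //.
  by apply: eq_from_tnth => j; rewrite tnth_mktuple.
have := invR f [tuple [tuple eval (A := A) (fun x => tnth (u x) j) (ts i) | j < tag R]
               | i < arity f].
rewrite (_ : [tuple op _ | _ < _] =
  [tuple op (a := A) [tuple eval (A := A) (fun x => tnth (u x) j) (ts i) | i < arity f]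
  | j < tag R]).
  by apply=> i; rewrite tnth_mktuple.
apply: eq_from_tnth => j; rewrite !tnth_mktuple; congr fop.
by apply: eq_from_tnth => i; rewrite !tnth_mktuple.
Qed.

(** * Joins over sets of elements *)

Section Joins.
Variables (S : signature) (A : fin_algebra S) (t : term S 'I_2).
Hypothesis ppA : pseudopartition A t.

Local Notation join := (eval2 (A := A) t).
Local Notation joins := (foldl join).
Implicit Types (u v x : A) (s : seq A).

(** All factors but the first one commute, and each of them can be absorbed by an
    equal factor that is already present. *)
Lemma joinRAC u v x : join (join u v) x = join (join u x) v.
Proof. by case: ppA => _ jA jC _; rewrite !jA jC. Qed.

Lemma joins_join u v s : joins (join u v) s = join (joins u s) v.
Proof. by elim: s u => //= x s IHs u; rewrite joinRAC IHs. Qed.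

Lemma join_joins u v s : join u (joins v s) = joins (join u v) s.
Proof. by case: ppA => _ jA _ _; elim: s v => //= x s IHs v; rewrite IHs jA. Qed.

Lemma joins_absorb u x s : x \in s -> join (joins u s) x = joins u s.
Proof.
case: ppA => jxx jA _ _; elim: s u => //= y s IHs u.
rewrite inE => /orP[/eqP ->|/IHs //]; by rewrite joins_join jA jxx.
Qed.

Lemma joins_sub u s s' : {subset s' <= s} -> joins (joins u s) s' = joins u s.
Proof.
elim: s' => //= x s' IHs' sub; rewrite joins_absorb ?sub ?inE ?eqxx //.
by apply: IHs' => y ys; apply: sub; rewrite inE ys orbT.
Qed.

Lemma joinsC u s s' : joins (joins u s) s' = joins (joins u s') s.
Proof. by elim: s' u => //= x s' IHs' u; rewrite -joins_join IHs'. Qed.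

Lemma eq_joins u s s' : s =i s' -> joins u s = joins u s'.
Proof.
move=> ss; rewrite -(@joins_sub u s s'); last by move=> x; rewrite ss.
by rewrite joinsC joins_sub // => x; rewrite ss.
Qed.

(** Joins of the same set differ only in the choice of the first factor, which the
    other join absorbs; this stays within a block. *)
Lemma sigma_joins u v s : u \in s -> v \in s -> sigma t (joins u s) (joins v s).
Proof.
have half x y : y \in s -> join (joins x s) (joins y s) = joins x s.
  by move=> ys; rewrite join_joins joins_absorb // joins_sub.
by move=> us vs; rewrite /sigma !half ?eqxx.
Qed.

End Joins.

(** * One algebra for all blocks *)

Section Blocks.
Variables (S : signature) (A : fin_algebra S).
Hypothesis idA : idempotent_algebra A.
Variable t : term S 'I_2.
Hypothesis ppA : pseudopartition A t.

Local Notation join := (eval2 (A := A) t).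

(** The product of the blocks of all the elements of [A], realised by functions on
    [A] in order to obtain a finite type: a selector chooses for each [a] an element of
    the block of [a]. *)
Definition selector : finType :=
  {g : {ffun A -> A} | [forall a, sigma (A := A) t a (g a)]}.

Lemma selectorP (g : selector) a : sigma (A := A) t a (val g a).
Proof. exact: forallP (valP g) a. Qed.

Fact selector_op_subproof f (xs : (arity f).-tuple selector) :
  [forall a, sigma (A := A) t a
    ([ffun a => op (a := A) (map_tuple (fun g : selector => val g a) xs)] a)].
Proof.
apply/forallP => a; rewrite ffunE.
apply: (@block_subuniverse S A t ppA idA a f).
by rewrite all_map; apply/allP => g _ /=; apply: selectorP.
Qed.

Definition selector_algebra : fin_algebra S :=
  @FinAlgebra S selector
    (fun f xs => exist _ [ffun a => op (a := A) (map_tuple (fun g : selector => val g a) xs)]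
                   (selector_op_subproof xs)).

(** Tabulating the elements of the product of the blocks makes the selectors a
    homomorphic image of it. *)
Lemma selector_in_variety (K : algebra S -> Prop) : variety K ->
  (forall a : A, K (block_algebra ppA idA a)) -> K selector_algebra.
Proof.
case=> homK _ prodK blocksK.
pose P := product_algebra (fun a : A => block_algebra ppA idA a).
have choose_proof (p : P) : [forall a, sigma (A := A) t a ([ffun a => val (p a)] a)].
  by apply/forallP => a; rewrite ffunE; apply: valP.
pose h (p : P) : selector_algebra := exist _ [ffun a => val (p a)] (choose_proof p).
apply: (homK P selector_algebra h); last exact: prodK.
  move=> f xs; apply: val_inj; apply/ffunP => a; rewrite !ffunE /=.
  by congr fop; apply: val_inj; rewrite /= -!map_comp; apply: eq_map => p /=; rewrite ffunE.
move=> g; exists (fun a => exist _ (val g a) (selectorP g a)).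
by apply: val_inj; apply/ffunP => a; rewrite !ffunE.
Qed.

Variable a0 : A.

(** The first factor has to belong to [V] for the block to depend on [V] alone; only
    the empty set gets the arbitrary element [a0]. *)
Definition representative (V : {set A}) : A :=
  foldl join (odflt a0 [pick x in V]) (enum V).

Lemma sigma_representative (V : {set A}) x : x \in V ->
  sigma (A := A) t (representative V) (foldl join x (enum V)).
Proof.
rewrite /representative => xV; case: pickP => [y yV|/(_ x)]; last by rewrite xV.
by apply: sigma_joins; rewrite ?mem_enum.
Qed.

(** The trace of [R] on the blocks of the representatives of the sets [b], as a
    relation between selectors: the coordinate of a selector at the representative
    is its component in that block. *)
Definition block_relation (R : relation A) (b : (tag R).-tuple {set A}) : relation selector :=
  existT _ (tag R) [set c : (tag R).-tuple selector |
    [tuple val (tnth c j) (representative (tnth b j)) | j < tag R] \in tagged R].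

Lemma Inv_block_relation R b :
  Inv (A := A) R -> Inv (A := selector_algebra) (@block_relation R b).
Proof.
move=> invR f xs xsR; rewrite inE.
pose ys := [tuple [tuple val (tnth (tnth xs i) j) (representative (tnth b j))
    | j < tag R] | i < arity f].
have ysR i : tnth ys i \in tagged R.
  by rewrite tnth_mktuple; have := xsR i; rewrite inE.
set result := (X in X \in _).
have -> : result = [tuple op (a := A) [tuple tnth (tnth ys i) j | i < arity f] | j < tag R];
  last exact: invR ysR.
apply: eq_from_tnth => j; rewrite !tnth_mktuple /= ffunE; congr fop.
by apply: eq_from_tnth => i; rewrite !(tnth_map, tnth_ord_tuple).
Qed.

Variable Delta : seq (relation A).
Hypothesis invDelta : forall R, R \in Delta -> Inv (A := A) R.

Definition block_relations : seq (relation selector) :=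
  [seq block_relation b | R <- Delta, b <- enum {: (tag R).-tuple {set A}}].

Lemma block_relations_Inv R : R \in block_relations -> Inv (A := selector_algebra) R.
Proof.
case/allpairsPdep => R' [b [R'D _ ->]]; apply: Inv_block_relation; exact: invDelta.
Qed.

(** The buffer is a sequence; the default is used only when its length is wrong. *)
Definition fit_tuple n (b : seq {set A}) : n.-tuple {set A} := insubd [tuple of nseq n set0] b.

Fact block_relation_mem (R : seq_sub Delta) (b : seq {set A}) :
  block_relation (fit_tuple (tag (val R)) b) \in block_relations.
Proof. by apply: allpairs_f_dep; rewrite ?mem_enum // (valP R). Qed.

Definition localize (R : seq_sub Delta) (b : seq {set A}) : seq_sub block_relations :=
  SeqSub (block_relation_mem R b).

Local Notation arityD := (@scope_size A Delta).

Lemma holds_localize (env : nat -> selector) (R : seq_sub Delta) (js : seq nat)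
    (b : seq {set A}) :
  size js = arityD R -> size b = arityD R ->
  holds (val (localize R b)) (map env js) =
  holds (val R) [seq val (env p.1) (representative p.2) | p <- zip js b].
Proof.
move=> szjs szb.
have szc : size (map env js) == tag (val R) by rewrite size_map szjs.
have -> : map env js = Tuple szc by [].
rewrite (holds_tuple (R := block_relation _)) inE.
rewrite -holds_tuple; congr holds.
have szz : size (zip js b) = tag (val R) by rewrite size_zip szjs szb minnn.
apply: (@eq_from_nth _ a0); rewrite size_tuple ?size_map ?szz // => k lt.
rewrite -(tnth_nth _ _ (Ordinal lt)) tnth_mktuple (nth_map (0, set0)) ?szz //.
rewrite nth_zip ?szjs ?szb // (tnth_nth (env 0)) [in LHS](nth_map 0) ?szjs //.
by rewrite (tnth_nth set0) val_insubd szb eqxx.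
Qed.

(** * Moving solutions into blocks *)

Section Solutions.
Variables (n : nat) (cs : seq (seq_sub Delta * seq nat)) (ds : seq {set A}).
Hypotheses (wfcs : well_formed arityD n cs) (szds : size ds = n).

Local Notation localized := (relabelled localize ds).

Lemma solves_delocalize env' :
  solves env' (map localized cs) ->
  solves (fun i => val (env' i) (representative (nth set0 ds i))) cs.
Proof.
rewrite /solves all_map; elim: (cs) wfcs => //= -[R js] cs' IHcs.
case/andP=> /andP[/eqP szjs _] wf' /andP[hR /(IHcs wf') ->]; rewrite andbT.
move: hR => /=; rewrite holds_localize ?size_map //.
congr holds.
by elim: (js) => //= j js' ->.
Qed.

(** Joining a tuple of the relation with all the tuples that lie in the product of
    the labels stays in the relation.  At each place, stability says that the tuples
    joined take exactly the values of the label there, so the result is described by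
    the labels alone, independently of the constraint at hand. *)
Lemma stable_holds (env : nat -> A) (R : seq_sub Delta) js :
  size js = arityD R -> holds (val R) (map env js) ->
  (forall i, i \in js -> env i \in nth set0 ds i) -> stable (@project A Delta) ds (R, js) ->
  holds (val R) [seq foldl join (env i) (enum (nth set0 ds i)) | i <- js].
Proof.
move=> szjs /exists_inP[r rR /eqP rE] wenv st.
set b := [seq nth set0 ds i | i <- js].
have invR : Inv (A := A) (val R) by apply: invDelta; apply: valP.
pose joint (u v : (tag (val R)).-tuple A) :=
  [tuple join (tnth u k) (tnth v k) | k < tag (val R)].
have jointR u v :
    u \in tagged (val R) -> v \in tagged (val R) -> joint u v \in tagged (val R).
  move=> uR vR; have := @Inv_term S A (val R) 'I_2 (tnth [tuple u; v]) t invR.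
  rewrite (_ : [tuple eval _ _ | _ < _] = joint u v).
    by apply=> x; case: (unliftP ord0 x) => [y ->|->]; rewrite ?ord1 ?tnth0 //.
  apply: eq_from_tnth => k; rewrite !tnth_mktuple; apply: eval_ext => x.
  by case: (unliftP ord0 x) => [y ->|->]; rewrite ?ord1.
pose rs := [seq u : (tag (val R)).-tuple A <- enum (tagged (val R)) | support b u].
have rsR u s : u \in tagged (val R) -> all [in tagged (val R)] s ->
    foldl joint u s \in tagged (val R).
  by elim: s u => //= v s IHs u uR /andP[vR /IHs]; apply; apply: jointR.
have tnth_joint u s k :
    tnth (foldl joint u s) k = foldl join (tnth u k) [seq tnth v k | v <- s].
  by elim: s u => //= v s IHs u; rewrite IHs tnth_mktuple.
have fR : foldl joint r rs \in tagged (val R).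
  by apply: rsR => //; apply/allP => v; rewrite mem_filter mem_enum => /andP[].
have -> : [seq foldl join (env i) (enum (nth set0 ds i)) | i <- js]
        = foldl joint r rs :> seq A.
  apply: (@eq_from_nth _ a0); rewrite size_map ?size_tuple // => k lt.
  have ltk : k < tag (val R) by rewrite -[tag _]szjs.
  rewrite (nth_map 0) // -(tnth_nth _ _ (Ordinal ltk)) tnth_joint (tnth_nth a0) /=.
  (* Both sides start with [env i]; it remains to compare the sets joined to it. *)
  rewrite rE (nth_map 0) //; apply: eq_joins => // a; rewrite mem_enum.
  have stk : nth set0 ds (nth 0 js k) \subset nth set0 (project R b) k.
    by have /(all2_nth _ 0 set0) -> := st; rewrite // size_mkseq.
  apply/idP/mapP => [aV|[v vrs ->]].
    have := subsetP stk a aV; rewrite nth_mkseq // inE => /exists_inP[v vR /andP[sv /eqP va]].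
    by exists v; [rewrite mem_filter sv mem_enum | rewrite (tnth_nth a)].
  move: vrs; rewrite mem_filter => /andP[/(@all2_nth _ _ _ a0 set0) sv _].
  have := sv _ k; rewrite !size_tuple (nth_map 0) // -(tnth_nth _ _ (Ordinal ltk)) size_map.
  by apply; rewrite ?szjs.
by rewrite holds_tuple.
Qed.

(** The value that the new solution prescribes lies in a single block, so a selector
    can take it on the whole of that block; elsewhere it is the identity. *)
Definition retract (env : nat -> A) (i : nat) : {ffun A -> A} :=
  let u := foldl join (env i) (enum (nth set0 ds i)) in
  [ffun a => if sigma (A := A) t a u then u else a].

Fact retract_subproof env i : [forall a, sigma (A := A) t a (retract env i a)].
Proof.
apply/forallP => a; rewrite ffunE; case: ifP => // _.
by case: ppA => jxx _ _ _; rewrite /sigma jxx eqxx.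
Qed.

Lemma solves_localize env :
  solves env cs -> within ds env -> all (stable (@project A Delta) ds) cs ->
  solves (fun i => exist _ (retract env i) (retract_subproof env i) : selector)
    (map localized cs).
Proof.
move=> sol wenv; rewrite /solves all_map; elim: (cs) wfcs sol => //= -[R js] cs' IHcs.
case/andP=> /andP[/eqP szjs ltjs] wf' /andP[hR sol] /andP[st sts].
rewrite IHcs // andbT /= holds_localize ?size_map //.
have inD i : i \in js -> env i \in nth set0 ds i.
  by move=> /(allP ltjs) lt; apply: wenv; rewrite szds.
have := stable_holds szjs hR inD st; congr holds.
elim: (js) inD => //= j js' IHjs inD.
rewrite IHjs; last by move=> i ij; apply: inD; rewrite inE ij orbT.
by rewrite ffunE sigma_representative // inD // inE eqxx.
Qed.

End Solutions.

Lemma localize_reduction (n : nat) cs ds :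
  well_formed arityD n cs -> size ds = n -> all (stable (@project A Delta) ds) cs ->
  (forall env, (forall c, c \in cs -> compatible (@project A Delta) env c) -> within ds env) ->
  (exists env, solves env cs) <-> (exists env, solves env (map (relabelled localize ds) cs)).
Proof.
move=> wf sz st sound; split=> [[env sol]|[env sol]]; last first.
  by eexists; apply: solves_delocalize wf _ sol.
eexists; apply: (solves_localize wf sz sol _ st); apply: sound => c cin.
by apply: holds_compatible; apply: (allP sol).
Qed.

Definition width := \max_(R : seq_sub Delta) arityD R.

Lemma relabelled_wf n cs ds : well_formed arityD n cs ->
  well_formed (@scope_size _ block_relations) n (map (relabelled localize ds) cs).
Proof. by rewrite /well_formed all_map. Qed.

(** The run on a word is unique, and so is the reading of a word as an instance:
    hence the instance that witnesses membership of a word is the one that the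
    transducer has translated, and likewise for its output. *)
Lemma CSP_reduction :
  reduces_within (propagator arityD width (@project A Delta) localize)
    (@CSP A Delta) (@CSP _ block_relations) (time A).
Proof.
have gA R : arityD R <= width by apply: leq_bigmax.
have szp := @size_project A Delta.
have done n cs := @propagator_done _ _ _ _ _ gA _ localize szp n cs.
have g0 : selector.
  exists [ffun a => a]; apply/forallP => a; rewrite ffunE /sigma.
  by case: ppA => jxx _ _ _; rewrite jxx eqxx.
move=> w.
have [[n [cs [wf wE]]]|[s [X [D [out run]]]]] :=
  @propagator_cases _ _ A _ _ gA _ localize szp w; last first.
  do 4!eexists; split; first exact: run.
  left; split=> // /(CSP_instance_word a0)[n [cs [wf wE _]]].
  have [ds [X' [D' [run' _ _ _]]]] := done n cs wf.
  rewrite -wE in run'.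
  by have := reach_uniq run erefl run' erefl.
have [ds [X [D [run sz st sound]]]] := done n cs wf.
rewrite -wE in run; do 4!eexists; split; first exact: run.
right; split=> //; have red := localize_reduction wf sz st sound.
have wf' := relabelled_wf ds wf.
rewrite (CSP_instance_word a0) (CSP_instance_word g0).
split=> [[n1 [cs1 [wf1 wE1 sol]]]|[n1 [cs1 [wf1 wE1 sol]]]].
  rewrite wE in wE1; have [nn csE] := instance_word_inj wf wf1 wE1.
  by exists n, (map (relabelled localize ds) cs); split=> //; apply/red; rewrite csE.
have [nn csE] := instance_word_inj wf' wf1 wE1.
by exists n, cs; split=> //; apply/red; rewrite csE.
Qed.

End Blocks.

(** Without nullary operations, the empty algebra embeds into every algebra. *)
Lemma empty_in_variety (S : signature) (A : fin_algebra S) (K : algebra S -> Prop)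
    (F : A -> algebra S) : plural S -> variety K -> (A -> False) -> (forall a, K (F a)) -> K A.
Proof.
move=> [ar_gt0 _] [_ subK prodK] emptyA KF.
apply: (subK A (product_algebra F) (fun a => match emptyA a with end)); last exact: prodK.
- by move=> f xs; case: (emptyA (tnth xs (Ordinal (ar_gt0 f)))).
- by move=> a; case: (emptyA a).
Qed.

Theorem theorem4p1 (S : signature) (hS : plural S) (A : fin_algebra S)
    (idA : idempotent_algebra A) (t : term S 'I_2) (ppA : pseudopartition A t)
    (K : algebra S -> Prop) (hK : tractable_variety K)
    (hblocks : forall a : A, K (block_algebra ppA idA a)) :
  tractable_algebra A.
Proof.
have [varK tractK] := hK.
case: (pickP (fun _ : A => true)) => [a0 _|emptyA]; last first.
  apply: tractK; apply: (empty_in_variety hS varK) hblocks => a.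
  by have := emptyA a.
move=> Delta invDelta.
have tractB := tractK _ (selector_in_variety varK hblocks).
apply: transducer_in_P (CSP_reduction ppA a0 invDelta) _.
apply: tractB => R; exact: block_relations_Inv.
Qed.
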